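(* Let $\mathcal B:[0,1]\to\dot{\mathcal H}^1\times\mathbb R$, $\mathcal B(s)=(\bar u_s,\bar k_s)$, be a bifurcation path satisfying Assumptions 1 and 2 stated in the context, for the crack energy $\mathcal E$ with pair potential $\phi\in C^\alpha(\mathbb R)$, $\alpha\ge5$. Then the set $\mathrm{Im}(\mathcal B)\subset\dot{\mathcal H}^1\times\mathbb R$ is a one-dimensional $C^{\alpha-1}$ manifold (with boundary points $\mathcal B(0),\mathcal B(1)$).
   Context: Lattice: $\Lambda=\{l-(\tfrac12,\tfrac12): l\in\mathbb Z^2\}$. $\Gamma_\pm=\{m\in\Lambda: m_1<0,\ m_2=\pm\tfrac12\}$. $\mathcal R=\{\pm e_1,\pm e_2\}$. $\tilde{\mathcal R}(m)=\mathcal R$ if $m\notin\Gamma_+\cup\Gamma_-$ and $\tilde{\mathcal R}(m)=\mathcal R\setminus\{\mp e_2\}$ if $m\in\Gamma_\pm$. For $u:\Lambda\to\mathbb R$: $D_\rho u(m)=u(m+\rho)-u(m)$, $Du(m)=(D_\rho u(m))_{\rho\in\mathcal R}$, and $\tilde Du(m)\in\mathbb R^{\mathcal R}$ has components $D_\rho u(m)$ if $\rho\in\tilde{\mathcal R}(m)$ and $0$ otherwise. $\dot{\mathcal H}^1=\{u:\Lambda\to\mathbb R:\ \tilde Du\in\ell^2,\ u(\tfrac12,\tfrac12)=0\}$, with inner product $(u,v)_{\dot{\mathcal H}^1}=\sum_{m}\tilde Du(m)\cdot\tilde Dv(m)$ and norm $\|\tilde Du\|_{\ell^2}$. Energy: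 $\hat u_k(x)=k\sqrt r\sin\frac\theta2$, polar coordinates centred at $0$, $\theta\in(-\pi,\pi)$. $V(Du(m))=\sum_{\rho\in\mathcal R}\phi(D_\rho u(m))$, $\phi\in C^\alpha(\mathbb R)$, $\alpha\ge5$, $\phi(0)=\phi'(0)=\phi'''(0)=0$, $\phi''(0)=1$, and $\phi'(r)=0$ for $|r|\ge R_\phi$, for some $R_\phi>0$. $\mathcal E:\dot{\mathcal H}^1\times\mathbb R\to\mathbb R$, $\mathcal E(u,k)=\sum_{m\in\Lambda}V(D\hat u_k(m)+Du(m))-V(D\hat u_k(m))$, is regarded as a $C^\alpha$ functional (the sums defining $\mathcal E$ and its derivatives are understood by continuous extension from displacements with compactly supported $Du$), with $\langle\delta_u\mathcal E(u,k),v\rangle=\sum_m\nabla V(D\hat u_k+Du)\cdot Dv$, $\langle\delta^2_{uu}\mathcal E(u,k)v,w\rangle=\sum_m\nabla^2V(D\hat u_k+Du)Dv\cdot Dw$, $\delta^2_{uk}\mathcal E(u,k)[v,\lambda]=\sum_m\nabla^2V(D\hat u_k+Du)[\lambda D\hat u_1]\cdot Dv$, $\delta^3_{uuu}\mathcal E(u,k)[v,w,z]=\sum_m\nabla^3V(D\hat u_k+Du)[Dv,Dw,Dz]$. $S=\{(u,k)\in\dot{\mathcal H}^1\times\mathbb R:\delta_u\mathcal E(u,k)=0\in(\dot{\mathcal H}^1)^*\}$. A point $(u,k)\in S$ is regular if $\delta^2_{uu}\mathcal E(u,k):\dot{\mathcal H}^1\to(\dot{\mathcal H}^1)^*$ is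 an isomorphism. It is a (simple quadratic) fold point if there is $\gamma\in\dot{\mathcal H}^1\setminus\{0\}$ with $\mathrm{Ker}\,\delta^2_{uu}\mathcal E(u,k)=\mathrm{span}\{\gamma\}$, $\delta^2_{uk}\mathcal E(u,k)[\gamma,1]\ne0$ and $\delta^3_{uuu}\mathcal E(u,k)[\gamma,\gamma,\gamma]\neq0$. Assumption 1: $\mathcal B:[0,1]\to\dot{\mathcal H}^1\times\mathbb R$ is injective and continuous, $\mathrm{Im}(\mathcal B)\subset S$ is compact, each $\mathcal B(s)$ is either a regular point or a fold point, and there are finitely many fold points, occurring at $s\in\{b_1,\dots,b_M\}\subset(0,1)$. Assumption 2: with $H_s=\delta^2_{uu}\mathcal E(\bar u_s,\bar k_s)$, there is $c>0$ such that for each $s\in[0,1]$ there is a subspace $U_s\subset\dot{\mathcal H}^1$ of codimension at most 1 with $\langle H_sv,v\rangle\ge c\|v\|_{\dot{\mathcal H}^1}^2$ for all $v\in U_s$. *)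

(* Defs.v *)
From HB Require Import structures.
From mathcomp Require Import all_boot all_order all_algebra.
From mathcomp Require Import all_classical all_reals all_analysis.
From mathcomp Require Import ring lra zify.

Set Implicit Arguments.
Unset Strict Implicit.
Unset Printing Implicit Defensive.

Import Order.TTheory GRing.Theory Num.Theory.
Import numFieldNormedType.Exports.

Local Open Scope classical_set_scope.
Local Open Scope ring_scope.

Section operators.
Context (R : realType).

Definition is_bounded_op (X Y : normedModType R) (f : X -> Y) : Prop :=
  linear f /\ exists M : R, forall x, `|f x| <= M * `|x|.

Definition bounded_op (X Y : normedModType R) : {pred X -> Y} :=
  mem [set f : X -> Y | is_bounded_op f].

Lemma bounded_op_submod_closed (X Y : normedModType R) :
  submod_closed (@bounded_op X Y).
Proof.
split=> [|a f g]; rewrite ?inE /=.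
  split=> [b u v|]; first by rewrite /= scaler0 addr0.
  by exists 0 => x; rewrite normr0 mul0r.
move=> [lf [M Mf]] [lg [N Ng]]; split=> [b u v|].
  rewrite !fctE/=.
  rewrite lf lg !scalerDr !scalerA (mulrC a b) !addrA; congr (_ + _).
  by rewrite -!addrA; congr (_ + _); rewrite addrC.
exists (`|a| * M + N) => x; rewrite !fctE/= mulrDl.
apply: le_trans (ler_normD _ _) _; apply: lerD (Ng x).
by rewrite normrZ -mulrA ler_wpM2l.
Qed.

HB.instance Definition _ (X Y : normedModType R) :=
  GRing.isSubmodClosed.Build R (X -> Y) (@bounded_op X Y)
    (bounded_op_submod_closed X Y).

Record Lop (X Y : normedModType R) :=
  MkLop { opfun :> X -> Y ; _ : opfun \in @bounded_op X Y }.

HB.instance Definition _ (X Y : normedModType R) := [isSub for @opfun X Y].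
HB.instance Definition _ (X Y : normedModType R) := [Choice of Lop X Y by <:].
HB.instance Definition _ (X Y : normedModType R) :=
  [SubChoice_isSubLmodule of Lop X Y by <:].

Definition opnorm (X Y : normedModType R) (f : Lop X Y) : R :=
  sup [set `|f x| | x in [set x : X | `|x| <= 1]].

Lemma Lop_linear (X Y : normedModType R) (f : Lop X Y) : linear f.
Proof. by case: f => f /=; rewrite inE => -[]. Qed.

Lemma Lop0 (X Y : normedModType R) (f : Lop X Y) : f 0 = 0.
Proof.
have := Lop_linear f 1 0 0.
by rewrite !scale1r addr0 => /eqP; rewrite eq_sym -subr_eq0 addrK => /eqP.
Qed.

Lemma LopZ (X Y : normedModType R) (f : Lop X Y) a x : f (a *: x) = a *: f x.
Proof. by have := Lop_linear f a x 0; rewrite !addr0 Lop0 addr0. Qed.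

Lemma opnorm_has_sup (X Y : normedModType R) (f : Lop X Y) :
  has_sup [set `|f x| | x in [set x : X | `|x| <= 1]].
Proof.
split; first by exists `|f 0|, 0 => //=; rewrite normr0.
case: f => f /=; rewrite inE => -[_ [M Mf]]; exists `|M| => _ [x /= x1 <-].
apply: le_trans (Mf x) _; apply: le_trans (ler_norm _) _.
by rewrite normrM ler_piMr// normr_id.
Qed.

Lemma opnorm_ge0 (X Y : normedModType R) (f : Lop X Y) : 0 <= opnorm f.
Proof.
apply: le_trans (normr_ge0 (f 0)) _; apply: ub_le_sup.
  by have [] := opnorm_has_sup f.
by exists 0 => //=; rewrite normr0.
Qed.

Lemma ler_opnorm (X Y : normedModType R) (f : Lop X Y) x :
  `|f x| <= opnorm f * `|x|.
Proof.
have [->|x0] := eqVneq x 0; first by rewrite Lop0 !normr0 mulr0.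
have x0' : 0 < `|x| by rewrite normr_gt0.
rewrite -ler_pdivrMr//.
have -> : `|f x| / `|x| = `|f (`|x|^-1 *: x)|.
  by rewrite LopZ normrZ gtr0_norm ?invr_gt0// mulrC.
apply: ub_le_sup; first by have [] := opnorm_has_sup f.
exists (`|x|^-1 *: x) => //=.
by rewrite normrZ gtr0_norm ?invr_gt0// mulVf// gt_eqF.
Qed.

Lemma opnorm_le (X Y : normedModType R) (f : Lop X Y) (M : R) :
  0 <= M -> (forall x, `|f x| <= M * `|x|) -> opnorm f <= M.
Proof.
move=> M0 Mf; apply: ge_sup; first by have [] := opnorm_has_sup f.
by move=> _ [x /= x1 <-]; apply: le_trans (Mf x) _; rewrite ler_piMr.
Qed.

Lemma opnormD (X Y : normedModType R) (f g : Lop X Y) :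
  opnorm (f + g) <= opnorm f + opnorm g.
Proof.
apply: opnorm_le => [|x]; first by rewrite addr_ge0 ?opnorm_ge0.
rewrite mulrDl; apply: le_trans (ler_normD _ _) _.
by rewrite lerD ?ler_opnorm.
Qed.

Lemma opnormZ (X Y : normedModType R) a (f : Lop X Y) :
  opnorm (a *: f) = `|a| * opnorm f.
Proof.
have le b (g : Lop X Y) : opnorm (b *: g) <= `|b| * opnorm g.
  apply: opnorm_le => [|x]; first by rewrite mulr_ge0 ?opnorm_ge0.
  by rewrite [opfun _]/= normrZ -mulrA ler_wpM2l ?ler_opnorm.
apply/eqP; rewrite eq_le le /=.
have [->|a0] := eqVneq a 0; first by rewrite normr0 mul0r opnorm_ge0.
have {1}-> : f = a^-1 *: (a *: f) by rewrite scalerA mulVf// scale1r.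
apply: le_trans (ler_wpM2l (normr_ge0 a) (le _ _)) _.
by rewrite mulrA -normrM divff// normr1 mul1r.
Qed.

Lemma opnorm0_eq0 (X Y : normedModType R) (f : Lop X Y) : opnorm f = 0 -> f = 0.
Proof.
move=> f0; apply/val_inj/funext => x /=.
apply/eqP; rewrite -normr_le0.
by have := ler_opnorm f x; rewrite f0 mul0r.
Qed.

HB.instance Definition _ (X Y : normedModType R) :=
  Lmodule_isNormed.Build R (Lop X Y) (@opnormD X Y) (@opnormZ X Y)
    (@opnorm0_eq0 X Y).

End operators.

Section smoothness.
Context (R : realType).

(* The Frechet derivative as an element of the space of bounded operators; it
   is the zero operator where the library's differential is not bounded. *)
Definition dop (X Y : normedModType R) (f : X -> Y) (x : X) : Lop X Y :=
  insubd (0 : Lop X Y) ('d f x : X -> Y).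

Fixpoint class_C (X : normedModType R) (n : nat) (Y : normedModType R)
    (W : set X) (f : X -> Y) {struct n} : Prop :=
  if n is n'.+1 then
    (forall x, W x -> differentiable f x) /\ class_C n' W (dop f)
  else forall x, W x -> {for x, continuous f}.

End smoothness.

Section manifold.
Context (R : realType) (V : normedModType R).

Definition submanifold1 (r : nat) (M bd : set V) : Prop :=
  bd `<=` M /\
  forall p, M p -> exists (O : set V) (eps : R) (g : R -> V) (h : V -> R),
    let J : set R :=
      if p \in bd then `[0, eps[%classic else `]- eps, eps[%classic in
    [/\ open O, O p, 0 < eps & g 0 = p] /\
    [/\ class_C r (`]- eps, eps[%classic : set R) g,
        forall t, `]- eps, eps[%classic t -> derive1 g t != 0,
        g @` J = M `&` O,
        {within M `&` O, continuous h} &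
        forall t, J t -> h (g t) = t].
End manifold.

(* The integer point l stands for the lattice point l - (1/2, 1/2). *)
Definition lattice : Type := (int * int)%type.
Definition e1 : lattice := (1, 0).
Definition e2 : lattice := (0, 1).
Definition nn : seq lattice := [:: e1; - e1; e2; - e2].

Section lattice.
Context (R : realType).
Implicit Types (u v : lattice -> R) (m rho : lattice).

Definition x1 m : R := m.1%:~R - 2^-1.
Definition x2 m : R := m.2%:~R - 2^-1.

Definition Gamma_plus m : bool := (x1 m < 0) && (x2 m == 2^-1).
Definition Gamma_minus m : bool := (x1 m < 0) && (x2 m == - 2^-1).

Definition bonds m : seq lattice :=
  [seq rho <- nn | ~~ (Gamma_plus m && (rho == - e2)) &&
                   ~~ (Gamma_minus m && (rho == e2))].

Definition D u m rho : R := u (m + rho) - u m.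
Definition Dt u m rho : R := if rho \in bonds m then D u m rho else 0.

Definition Dt_sq u m : R := \sum_(rho <- nn) Dt u m rho ^+ 2.

Definition H1pred : {pred lattice -> R} :=
  mem [set u : lattice -> R |
        (\esum_(m in [set: lattice]) (Dt_sq u m)%:E < +oo)%E /\ u (1, 1) = 0].

Lemma DtP u v a m rho : Dt (a *: u + v) m rho = a * Dt u m rho + Dt v m rho.
Proof.
rewrite /Dt; case: ifP => _; last by rewrite mulr0 addr0.
change (a * u (m + rho) + v (m + rho) - (a * u m + v m) = a * (u (m + rho) - u m) + (v (m + rho) - v m)); ring.
Qed.

Lemma Dt_sq_ge0 u m : 0 <= Dt_sq u m.
Proof. by rewrite sumr_ge0// => rho _; rewrite sqr_ge0. Qed.

Lemma Dt_sqZ a u m : Dt_sq (a *: u) m = a ^+ 2 * Dt_sq u m.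
Proof.
rewrite /Dt_sq mulr_sumr; apply: eq_bigr => rho _.
have := DtP u 0 a m rho; rewrite addr0 => ->.
suff -> : Dt 0 m rho = 0 by rewrite addr0 exprMn.
by rewrite /Dt; case: ifP => // _; exact: subrr.
Qed.

Lemma Dt_sqD u v t m : 0 < t ->
  Dt_sq (u + v) m <= (1 + t) * Dt_sq u m + (1 + t^-1) * Dt_sq v m.
Proof.
move=> t0; rewrite /Dt_sq !mulr_sumr -big_split/=; apply: ler_sum => rho _.
have := DtP u v 1 m rho; rewrite scale1r mul1r => ->.
move: (Dt u m rho) (Dt v m rho) => a b.
rewrite -subr_ge0.
have -> : (1 + t) * a ^+ 2 + (1 + t^-1) * b ^+ 2 - (a + b) ^+ 2 =
  t^-1 * (t * a - b) ^+ 2 by field; rewrite gt_eqF.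
by rewrite mulr_ge0 ?sqr_ge0// invr_ge0 ltW.
Qed.

Lemma esum_Dt_sq_ge0 u :
  (0 <= \esum_(m in [set: lattice]) (Dt_sq u m)%:E)%E.
Proof. by apply: esum_ge0 => m _; rewrite lee_fin Dt_sq_ge0. Qed.

Lemma esum_Dt_sq_le u (c : R) :
  (forall A : set lattice, finite_set A -> \sum_(m \in A) Dt_sq u m <= c) ->
  (\esum_(m in [set: lattice]) (Dt_sq u m)%:E <= c%:E)%E.
Proof.
move=> Ac; apply: ge_ereal_sup => _ [A [finA _] <-].
by rewrite fsumEFin// lee_fin Ac.
Qed.

Lemma le_esum_Dt_sq u (A : set lattice) : finite_set A ->
  (\esum_(m in [set: lattice]) (Dt_sq u m)%:E < +oo)%E ->
  \sum_(m \in A) Dt_sq u m <=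
    fine (\esum_(m in [set: lattice]) (Dt_sq u m)%:E)%E.
Proof.
move=> finA finu; rewrite -lee_fin -fsumEFin// fineK; last first.
  by rewrite ge0_fin_numE// esum_Dt_sq_ge0.
by apply: ereal_sup_ubound; exists A.
Qed.

Lemma sum_Dt_sqD u v t (A : set lattice) : finite_set A -> 0 < t ->
  \sum_(m \in A) Dt_sq (u + v) m <=
  (1 + t) * (\sum_(m \in A) Dt_sq u m) + (1 + t^-1) * (\sum_(m \in A) Dt_sq v m).
Proof.
move=> finA t0; rewrite !fsbig_finite//= !mulr_sumr -big_split/=.
by apply: ler_sum => m _; exact: Dt_sqD.
Qed.

Lemma H1_submod_closed : submod_closed H1pred.
Proof.
have finZ a u : (\esum_(m in [set: lattice]) (Dt_sq u m)%:E < +oo)%E ->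
    (\esum_(m in [set: lattice]) (Dt_sq (a *: u) m)%:E < +oo)%E.
  move=> fu; apply: le_lt_trans (esum_Dt_sq_le _) (ltry _) => A finA.
  under eq_fsbigr do rewrite Dt_sqZ.
  rewrite fsbig_finite//= -mulr_sumr -fsbig_finite//.
  by apply: ler_wpM2l (le_esum_Dt_sq finA fu); rewrite sqr_ge0.
split=> [|a u v]; rewrite ?inE /=.
  split=> //; apply: le_lt_trans (ltry 0).
  apply: esum_Dt_sq_le => A finA; rewrite fsbig1//= => m _.
  by rewrite -(scale0r 0) Dt_sqZ expr0n mul0r.
move=> [/(finZ a) fu u0] [fv v0]; split; last first.
  change (a * u (1, 1) + v (1, 1) = 0); by rewrite u0 v0 mulr0 addr0.
apply: le_lt_trans (esum_Dt_sq_le _) (ltry _) => A finA.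
apply: le_trans (sum_Dt_sqD _ _ finA ltr01) _.
by apply: lerD; (apply: ler_wpM2l (le_esum_Dt_sq finA _) => //); lra.
Qed.

HB.instance Definition _ :=
  GRing.isSubmodClosed.Build R (lattice -> R) H1pred H1_submod_closed.

Record H1 := MkH1 { disp :> lattice -> R ; _ : disp \in H1pred }.

HB.instance Definition _ := [isSub for disp].
HB.instance Definition _ := [Choice of H1 by <:].
HB.instance Definition _ := [SubChoice_isSubLmodule of H1 by <:].

Definition H1norm (u : H1) : R :=
  Num.sqrt (fine (\esum_(m in [set: lattice]) (Dt_sq u m)%:E)).

Lemma H1_fin (u : H1) : (\esum_(m in [set: lattice]) (Dt_sq u m)%:E < +oo)%E.
Proof. by case: u => u /=; rewrite inE => -[]. Qed.

Lemma H1_pin (u : H1) : u (1, 1) = 0.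
Proof. by case: u => u /=; rewrite inE => -[]. Qed.

Lemma H1norm_ge0 (u : H1) : 0 <= H1norm u.
Proof. exact: sqrtr_ge0. Qed.

Lemma H1norm_sq (u : H1) :
  H1norm u ^+ 2 = fine (\esum_(m in [set: lattice]) (Dt_sq u m)%:E)%E.
Proof. by rewrite sqr_sqrtr// fine_ge0// esum_Dt_sq_ge0. Qed.

Lemma sum_Dt_sq_le_norm (u : H1) (A : set lattice) : finite_set A ->
  \sum_(m \in A) Dt_sq u m <= H1norm u ^+ 2.
Proof. by move=> finA; rewrite H1norm_sq le_esum_Dt_sq// H1_fin. Qed.

Lemma H1norm_le (u : H1) (c : R) : 0 <= c ->
  (forall A : set lattice, finite_set A -> \sum_(m \in A) Dt_sq u m <= c ^+ 2) ->
  H1norm u <= c.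
Proof.
move=> c0 Ac; rewrite -(@ler_pXn2r _ 2)// ?nnegrE ?H1norm_ge0// H1norm_sq.
rewrite -lee_fin fineK; last by rewrite ge0_fin_numE ?esum_Dt_sq_ge0 ?H1_fin.
exact: esum_Dt_sq_le.
Qed.

Lemma H1norm0_Dt (u : H1) m rho : rho \in nn -> H1norm u = 0 -> Dt u m rho = 0.
Proof.
move=> rhonn u0; have := @sum_Dt_sq_le_norm u [set m] (finite_set1 m).
rewrite fsbig_set1 u0 expr0n /= => le0.
have /eqP : Dt_sq u m = 0 by apply/eqP; rewrite eq_le le0 Dt_sq_ge0.
rewrite psumr_eq0; last by move=> ? _; rewrite sqr_ge0.
by move=> /allP /(_ rho rhonn) /=; rewrite sqrf_eq0 => /eqP.
Qed.

Lemma x1_lt0 m : (x1 m < 0) = (m.1 <= 0)%R.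
Proof.
rewrite /x1; have [le0|gt0] := leP m.1 0.
  have : (m.1%:~R <= 0 :> R) by rewrite lerz0.
  by move=> ?; apply/idP; lra.
have : (1 <= m.1%:~R :> R) by rewrite ler1z.
by move=> ?; apply/negP; lra.
Qed.

Lemma Gamma_plusE m : Gamma_plus m = (m.1 <= 0) && (m.2 == 1).
Proof.
rewrite /Gamma_plus x1_lt0 /x2; congr andb.
rewrite subr_eq -(eqr_int R); congr (_ == _); lra.
Qed.

Lemma Gamma_minusE m : Gamma_minus m = (m.1 <= 0) && (m.2 == 0).
Proof.
rewrite /Gamma_minus x1_lt0 /x2; congr andb.
by rewrite subr_eq addNr -(eqr_int R).
Qed.

Lemma H1norm0_eq0 (u : H1) : H1norm u = 0 -> u = 0.
Proof.
move=> u0.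
have hor (a b : int) : u (a + 1, b) = u (a, b).
  have := @H1norm0_Dt u (a, b) e1 isT u0; rewrite /Dt /D.
  rewrite mem_filter !andbF/= => /eqP; rewrite subr_eq0 => /eqP.
  by rewrite [X in u X](_ : _ = (a + 1, b)%R) //; congr pair; rewrite addr0.
have ver (a b : int) : (1 <= a) || (b != 0) -> u (a, b + 1) = u (a, b).
  move=> ab; have := @H1norm0_Dt u (a, b) e2 isT u0; rewrite /Dt /D.
  rewrite mem_filter Gamma_minusE/= !andbF andbT/=.
  have -> : (a <= 0) && (b == 0) = false.
    by case/orP: ab => [a1|/negPf->]; [apply/negP => /andP[]; lia|rewrite andbF].
  move=> /= /eqP; rewrite subr_eq0 => /eqP.
  by rewrite [X in u X](_ : _ = (a, b + 1)%R) //; congr pair; rewrite addr0.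
have horA (b : int) (n : nat) (a : int) : u (a + n%:Z, b) = u (a, b).
  elim: n => [|n IH]; first by rewrite addr0.
  by rewrite -IH -[RHS]hor; congr (u (_, _)); lia.
have hor1 (a b : int) : u (a, b) = u (1, b).
  have [a1|a1] := leP 1 a.
    by rewrite -(horA b `|a - 1|%N 1); congr (u (_, _)); lia.
  by rewrite -(horA b `|1 - a|%N a); congr (u (_, _)); lia.
have verA (n : nat) (b : int) : u (1, b + n%:Z) = u (1, b).
  elim: n => [|n IH]; first by rewrite addr0.
  by rewrite -IH -[RHS]ver//; congr (u (_, _)); lia.
apply/val_inj/funext => -[a b] /=; rewrite hor1.
transitivity (u (1, 1)); last exact: H1_pin.
have [b1|b1] := leP 1 b.
  by rewrite -(verA `|b - 1|%N 1); congr (u (_, _)); lia.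
by rewrite -(verA `|1 - b|%N b); congr (u (_, _)); lia.
Qed.

Lemma H1normZ a (u : H1) : H1norm (a *: u) = `|a| * H1norm u.
Proof.
have le b (v : H1) : H1norm (b *: v) <= `|b| * H1norm v.
  apply: H1norm_le => [|A finA]; first by rewrite mulr_ge0 ?H1norm_ge0.
  have -> : \sum_(m \in A) Dt_sq (b *: v) m = b ^+ 2 * \sum_(m \in A) Dt_sq v m.
    under eq_fsbigr do rewrite Dt_sqZ.
    by rewrite fsbig_finite//= -mulr_sumr -fsbig_finite.
  by rewrite exprMn real_normK ?num_real// ler_wpM2l ?sqr_ge0 ?sum_Dt_sq_le_norm.
apply/eqP; rewrite eq_le le /=.
have [->|a0] := eqVneq a 0; first by rewrite normr0 mul0r H1norm_ge0.
have {1}-> : u = a^-1 *: (a *: u) by rewrite scalerA mulVf// scale1r.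
apply: le_trans (ler_wpM2l (normr_ge0 a) (le _ _)) _.
by rewrite mulrA -normrM divff// normr1 mul1r.
Qed.

Lemma H1normD (u v : H1) : H1norm (u + v) <= H1norm u + H1norm v.
Proof.
have [u0|u0] := eqVneq (H1norm u) 0.
  by rewrite u0 (H1norm0_eq0 u0) !add0r.
have [v0|v0] := eqVneq (H1norm v) 0.
  by rewrite v0 (H1norm0_eq0 v0) !addr0.
have {}u0 : 0 < H1norm u by rewrite lt_neqAle eq_sym u0 H1norm_ge0.
have {}v0 : 0 < H1norm v by rewrite lt_neqAle eq_sym v0 H1norm_ge0.
apply: H1norm_le => [|A finA]; first by rewrite addr_ge0 ?H1norm_ge0.
have t0 : 0 < H1norm v / H1norm u by rewrite divr_gt0.
apply: le_trans (sum_Dt_sqD u v finA t0) _.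
have -> : (H1norm u + H1norm v) ^+ 2 =
    (1 + H1norm v / H1norm u) * H1norm u ^+ 2 +
    (1 + (H1norm v / H1norm u)^-1) * H1norm v ^+ 2.
  by field; rewrite !gt_eqF.
apply: lerD; apply: ler_wpM2l; rewrite ?sum_Dt_sq_le_norm//.
  by rewrite addr_ge0// ltW.
by rewrite addr_ge0// invr_ge0 ltW.
Qed.

HB.instance Definition _ :=
  Lmodule_isNormed.Build R H1 H1normD H1normZ H1norm0_eq0.

End lattice.

Section energy.
Context (R : realType).
Implicit Types (phi : R -> R) (k : R) (m : lattice).

Definition radius m : R := Num.sqrt (x1 R m ^+ 2 + x2 R m ^+ 2).

Definition angle m : R := Num.sg (x2 R m) * acos (x1 R m / radius m).

Lemma x2_neq0 m : x2 R m != 0.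
Proof.
rewrite /x2 subr_eq0; apply/eqP => m2.
have : (m.2 * 2)%:~R = 1%:~R :> R by rewrite intrM m2 mulVf// pnatr_eq0.
by move=> /intr_inj; lia.
Qed.

Lemma polar_coordinates m :
  [/\ - pi < angle m < pi, x1 R m = radius m * cos (angle m) &
      x2 R m = radius m * sin (angle m)].
Proof.
have r2 : radius m ^+ 2 = x1 R m ^+ 2 + x2 R m ^+ 2.
  by rewrite sqr_sqrtr// addr_ge0 ?sqr_ge0.
have x20 : 0 < x2 R m ^+ 2 by rewrite exprn_even_gt0//= x2_neq0.
have r0 : 0 < radius m by rewrite sqrtr_gt0 ltr_wpDl ?sqr_ge0.
set c := x1 R m / radius m.
have x1E : x1 R m = radius m * c by rewrite mulrC divfK// gt_eqF.
have c2 : c ^+ 2 < 1.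
  by rewrite expr_div_n ltr_pdivrMr ?exprn_gt0// mul1r r2 ltrDl.
have cB : -1 < c < 1 by rewrite -ltr_norml -[ltRHS]sqrtr1 -sqrtr_sqr ltr_sqrt.
have [c1 c1'] := andP cB.
have aB : acos c < pi by apply: acos_ltpi; rewrite c1 ltW.
have a0 : 0 < acos c by apply: acos_gt0; rewrite (ltW c1).
have cosE : cos (acos c) = c by rewrite acosK// in_itv/= !ltW.
have sinE : radius m * sin (acos c) = `|x2 R m|.
  rewrite sin_acos ?(ltW c1) ?(ltW c1')// -[X in X * _]gtr0_norm//.
  rewrite -sqrtr_sqr -sqrtrM ?sqr_ge0// mulrBr mulr1 -exprMn -x1E r2.
  by rewrite addrAC subrr add0r sqrtr_sqr.
rewrite /angle -/c.
have [x2p|x2n|x2z] := ltrgtP (x2 R m) 0.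
- rewrite ltr0_sg// mulN1r cosN sinN mulrN sinE cosE -x1E ltr0_norm// opprK.
  by split=> //; rewrite ltrN2 aB/=; lra.
- rewrite gtr0_sg// mul1r sinE cosE -x1E gtr0_norm//.
  by split=> //; rewrite aB andbT; lra.
- by have := x2_neq0 m; rewrite x2z eqxx.
Qed.

Definition uhat k m : R := k * Num.sqrt (radius m) * sin (angle m / 2).

Definition V phi (g : lattice -> R) : R := \sum_(rho <- nn) phi (g rho).

Definition pair_potential (alpha : nat) phi : Prop :=
  class_C alpha setT phi /\
  [/\ phi 0 = 0, derive1n 1 phi 0 = 0, derive1n 2 phi 0 = 1,
      derive1n 3 phi 0 = 0 &
      exists2 Rphi : R, 0 < Rphi & forall r, Rphi <= `|r| -> derive1 phi r = 0].

Definition compact_grad (u : lattice -> R) : Prop :=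
  finite_set [set m | exists2 rho, rho \in nn & D u m rho != 0].

(* Only used when Du has finite support, and then so has the summand. *)
Definition energy_sum phi (u : lattice -> R) k : R :=
  \sum_(m \in [set: lattice])
    (V phi (D (uhat k) m + D u m) - V phi (D (uhat k) m)).

(* The displacements with compactly supported Du are dense in H1, so on the
   open set W these conditions determine E: it is the continuous extension of
   the lattice sum. W cannot be everything: at k = 0 the bonds across the crack
   make the sum discontinuous in the H1 norm, and no extension exists. *)
Definition crack_energy (alpha : nat) phi (W : set (H1 R * R))
    (E : H1 R * R -> R) : Prop :=
  [/\ open W,
      forall (u : H1 R) k, W (u, k) -> compact_grad u ->
        E (u, k) = energy_sum phi u k &
      class_C alpha W E].

End energy.

Section bifurcation.
Context (R : realType).
Notation H := (H1 R).
Implicit Types (E : H * R -> R) (z : H * R) (B : R -> H * R).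

Definition d_u E z : Lop H R := dop (fun u : H => E (u, z.2)) z.1.

Definition d_uu E z : Lop H (Lop H R) := dop (fun u : H => d_u E (u, z.2)) z.1.

Definition d_uk E z : Lop R (Lop H R) := dop (fun k : R => d_u E (z.1, k)) z.2.

Definition d_uuu E z : Lop H (Lop H (Lop H R)) :=
  dop (fun u : H => d_uu E (u, z.2)) z.1.

Definition critical E : set (H * R) := [set z | d_u E z = 0].

Definition isomorphism (X Y : normedModType R) (A : Lop X Y) : Prop :=
  exists A' : Lop Y X, cancel A A' /\ cancel A' A.

Definition regular_point E z : Prop := critical E z /\ isomorphism (d_uu E z).

Definition fold_point E z : Prop :=
  critical E z /\
  exists gamma : H,
    [/\ gamma != 0,
        forall v : H, d_uu E z v = 0 <-> exists a : R, v = a *: gamma,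
        d_uk E z 1 gamma != 0 &
        d_uuu E z gamma gamma gamma != 0].

Definition assumption1 E B : Prop :=
  [/\ {within `[0, 1], continuous B} /\ {in `[0, 1]%R &, injective B},
      B @` `[0, 1] `<=` critical E,
      compact (B @` `[0, 1]),
      forall s, `[0, 1]%classic s ->
        regular_point E (B s) \/ fold_point E (B s) &
      exists b : seq R,
        {subset b <= `]0, 1[%R} /\
        forall s, `[0, 1]%classic s -> (fold_point E (B s) <-> s \in b)].

Definition subspace (X : lmodType R) (U : set X) : Prop :=
  U 0 /\ forall (a : R) v w, U v -> U w -> U (a *: v + w).

Definition codim_le1 (X : lmodType R) (U : set X) : Prop :=
  exists e : X, forall v, exists a : R, U (v - a *: e).

Definition assumption2 E B : Prop :=
  exists2 c : R, 0 < c &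
    forall s, `[0, 1]%classic s -> exists U : set H,
      [/\ subspace U, codim_le1 U &
          forall v, U v -> c * `|v| ^+ 2 <= d_uu E (B s) v v].

End bifurcation.

(* Main.v *)
(* Near a point p of the path, adjoin to F(u,k) = d_u E(u,k) = 0 the scalar
   equation l(u,k) = l(p) + t. At a regular point take l(u,k) = k; at a fold
   point take for l a functional of u alone with l(gamma) = 1. The derivative of
   (F, l) at p is then invertible: in the fold case the Hessian is symmetric with
   gamma in its kernel, it is coercive on ker l by Assumption 2, and
   d_uk E [gamma] <> 0 fixes the component along k. As E is C^alpha and H1 is
   complete, the inverse function theorem gives a C^(alpha-1) curve g(t) through
   all the solutions near p. Along the path, t = l(B s) - l(p) is a continuous
   injective function of s, so near p the image of B is the whole curve g, or one
   half of it when p is an end point. *)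

From HB Require Import structures.
Require Import Defs.
From mathcomp Require Import all_boot all_order all_algebra finmap.
From mathcomp Require Import all_classical all_reals all_analysis.
From mathcomp Require Import ring lra zify.

Set Implicit Arguments.
Unset Strict Implicit.
Unset Printing Implicit Defensive.

Import Order.TTheory GRing.Theory Num.Theory.
Import numFieldNormedType.Exports.

Local Open Scope classical_set_scope.
Local Open Scope ring_scope.

(** * Frechet derivatives *)

(** Two obstacles shape the argument. The first is the class of [g]. Smoothness of an inverse map
    usually rests on smoothness of operator inversion, with higher derivatives in nested operator
    spaces. Here the right-hand side moves along a line only, so [g] is a curve whose velocity
    solves the linear equation [dop G (g t) v = e]. A lower bound on [dop G z], uniform for [z] near
    [p], then gains one derivative of [g] per round, and all these derivatives stay in the same
    space. The second is global. Local uniqueness describes all solutions near [p], but not which of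
    them the path visits. At an interior point the two halves of the path leave [p] on opposite
    sides of the level [l p], so together they fill the curve. At an end point the other half of the
    curve must be shown free of remote parts of the path: by compactness of the parameter interval
    and injectivity, these keep a positive distance from [p]. *)

Section bounded_operators.
Context (R : realType).
Implicit Types X Y Z : normedModType R.

Lemma LopD X Y (f : Lop X Y) x y : f (x + y) = f x + f y.
Proof. by have := Lop_linear f 1 x y; rewrite !scale1r. Qed.

Lemma LopZR X (f : Lop X R) (a : R) x : f (a *: x) = a * f x.
Proof. exact: LopZ. Qed.

Lemma LopN X Y (f : Lop X Y) x : f (- x) = - f x.
Proof. by rewrite -scaleN1r LopZ scaleN1r. Qed.

Lemma LopB X Y (f : Lop X Y) x y : f (x - y) = f x - f y.
Proof. by rewrite LopD LopN. Qed.

Lemma ler_Lop X Y (f : Lop X Y) x : `|f x| <= `|f| * `|x|.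
Proof. exact: ler_opnorm. Qed.

Lemma Lop_norm_le X Y (f : Lop X Y) (M : R) :
  0 <= M -> (forall x, `|f x| <= M * `|x|) -> `|f| <= M.
Proof. exact: opnorm_le. Qed.

Lemma Lop_exists X Y (f : X -> Y) (M : R) :
  linear f -> (forall x, `|f x| <= M * `|x|) ->
  exists F : Lop X Y, forall x, F x = f x.
Proof.
move=> lf Mf.
have fb : f \in @bounded_op R X Y by rewrite inE; split=> //; exists M.
by exists (MkLop fb).
Qed.

Lemma LopP X Y (f g : Lop X Y) : (forall x, f x = g x) -> f = g.
Proof. by move=> fg; apply/val_inj/funext. Qed.

Lemma Lop_continuous X Y (f : Lop X Y) : continuous f.
Proof.
move=> x; apply/(@cvgrPdist_le _ _ _ (nbhs x)) => e e0.
have M0 : 0 < `|f| + 1 by rewrite ltr_wpDl.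
near=> y; rewrite -LopB; apply: le_trans (ler_Lop _ _) _.
apply: (@le_trans _ _ ((`|f| + 1) * `|x - y|)).
  by rewrite ler_wpM2r// lerDl.
rewrite -ler_pdivlMl//; near: y.
by apply: cvgr_dist_le => //; rewrite mulr_gt0 ?invr_gt0.
Unshelve. all: by end_near. Qed.

End bounded_operators.

Section frechet.
Context (R : realType).
Implicit Types X Y Z : normedModType R.

Definition small_o X Y (r : X -> Y) : Prop :=
  forall e : R, 0 < e -> exists2 d : R, 0 < d &
    forall v, `|v| < d -> `|r v| <= e * `|v|.

Lemma small_oD X Y (r s : X -> Y) :
  small_o r -> small_o s -> small_o (fun v => r v + s v).
Proof.
move=> hr hs e e0; have e2 : 0 < e / 2 by rewrite divr_gt0.
have [d d0 K] := hr _ e2; have [d' d'0 K'] := hs _ e2.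
exists (Num.min d d'); first by rewrite lt_min d0 d'0.
move=> v; rewrite lt_min => /andP[vd vd']; apply: le_trans (ler_normD _ _) _.
by apply: le_trans (lerD (K v vd) (K' v vd')) _; rewrite -mulrDl -splitr.
Qed.

Lemma small_o_le X Y Z (r : X -> Y) (s : X -> Z) (M : R) (d : R) :
  0 < d -> (forall v, `|v| < d -> `|s v| <= M * `|r v|) ->
  small_o r -> small_o s.
Proof.
move=> d0 sr hr e e0; have M0 : 0 < `|M| + 1 by rewrite ltr_wpDl.
have [d' d'0 K] := hr (e / (`|M| + 1)) (divr_gt0 e0 M0).
exists (Num.min d d'); first by rewrite lt_min d0 d'0.
move=> v; rewrite lt_min => /andP[vd vd']; apply: le_trans (sr v vd) _.
apply: (@le_trans _ _ ((`|M| + 1) * `|r v|)).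
  by rewrite ler_wpM2r// (le_trans (ler_norm M))// lerDl.
by rewrite -ler_pdivlMl//; apply: le_trans (K v vd') _; rewrite mulrCA mulrA.
Qed.

Lemma small_o_eq X Y (r s : X -> Y) :
  (forall v, s v = r v) -> small_o r -> small_o s.
Proof. by move=> /funext ->. Qed.

(** [L] is a bare function, so that a derivative can be written as a lambda term; linearity and
    boundedness enter only when [fderivP] identifies it with [dop]. *)
Definition fderiv X Y (f : X -> Y) (x : X) (L : X -> Y) : Prop :=
  small_o (fun v => f (x + v) - f x - L v).

Lemma nbhsP_norm X (x : X) (P : set X) :
  nbhs x P <-> exists2 d : R, 0 < d & forall v, `|v| < d -> P (x + v).
Proof.
split.
  move=> /nbhs_normP [d d0 H]; exists d => // v vd.
  by apply: H; rewrite /= opprD addNKr normrN.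
move=> [d d0 H]; apply/nbhs_normP; exists d => // v /= vd.
by rewrite -(subrK x v) addrC; apply: H; rewrite distrC.
Qed.

Lemma continuousP_norm X Y (f : X -> Y) (x : X) :
  {for x, continuous f} <-> forall e : R, 0 < e -> exists2 d : R, 0 < d &
    forall v, `|v| < d -> `|f (x + v) - f x| <= e.
Proof.
split.
  move=> /cvgrPdist_le H e e0.
  have /nbhsP_norm [d d0 K] := H e e0.
  by exists d => // v vd; rewrite distrC; exact: K.
move=> H; apply/cvgrPdist_le => e e0; apply/nbhsP_norm.
have [d d0 K] := H e e0; exists d => // v vd /=.
by rewrite distrC; exact: K.
Qed.

(** Differentiability includes continuity of the differential, and a continuous linear map is
    bounded; hence [insubd] keeps the differential and does not fall back to zero. *)
Lemma dopE X Y (f : X -> Y) (x : X) :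
  differentiable f x -> (dop f x : X -> Y) = 'd f x.
Proof.
move=> df; rewrite /dop /insubd insubT//= inE.
split; first by move=> a u v; rewrite linearP.
have /linear_bounded_continuous/linear_boundedP := diff_continuous df.
by move=> /pinfty_ex_gt0 [M _ HM]; exists M.
Qed.

Lemma differentiable_fderiv X Y (f : X -> Y) (x : X) :
  differentiable f x -> fderiv f x (dop f x).
Proof.
move=> df; rewrite dopE//.
have /diff_locallyP [dfc /eqaddoP H] := df.
move=> e e0; have /nbhsP_norm [d d0 K] := H e e0; exists d => // v vd.
have := K v vd; rewrite /= add0r.
rewrite -[X in `|X| <= _]/(f (v + x) - (f x + 'd f x v)).
by rewrite opprD addrA (addrC v x).
Qed.

(** A bounded operator is continuous, and the differential is unique among continuous linear maps
    with this expansion. [L] is repacked as a linear map so that [diff_unique] applies. *)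
Lemma fderivP X Y (f : X -> Y) (x : X) (L : Lop X Y) :
  fderiv f x L -> differentiable f x /\ dop f x = L.
Proof.
move=> fL.
pose L' : {linear X -> Y} := HB.pack (L : X -> Y)
  (GRing.isLinear.Build _ _ _ _ (L : X -> Y) (Lop_linear L)).
have lo : f \o shift x = cst (f x) + L' +o_ 0 id.
  apply/eqaddoP => e e0; apply/nbhsP_norm; have [d d0 K] := fL e e0.
  exists d => // v vd; rewrite add0r.
  rewrite -[X in `|X| <= _]/(f (v + x) - (f x + L v)).
  by rewrite opprD addrA (addrC v x); exact: K.
have dE : 'd f x = L' :> (X -> Y) by apply: diff_unique lo; exact: Lop_continuous.
split.
  apply/diff_locallyP; split; first by rewrite dE; exact: Lop_continuous.
  by rewrite dE.
apply/val_inj; rewrite /dop /insubd /=.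
rewrite insubT ?dE//=; by case: (L).
Qed.

End frechet.

Arguments small_o_le {R X Y Z r s} M {d}.

Section frechet_calculus.
Context (R : realType).
Implicit Types X Y Z : normedModType R.

Lemma fderiv_continuous X Y (f : X -> Y) (x : X) (L : Lop X Y) :
  fderiv f x L -> {for x, continuous f}.
Proof. by move=> /fderivP[df _]; exact: differentiable_continuous. Qed.

Lemma fderiv_near X Y (f g : X -> Y) (x : X) (L : X -> Y) :
  (\forall y \near x, f y = g y) -> fderiv f x L -> fderiv g x L.
Proof.
move=> /nbhsP_norm[r r0 fg] fL e e0; have [d d0 K] := fL e e0.
have fgx : f x = g x by rewrite -[x]addr0; apply: fg; rewrite normr0.
exists (Num.min d r); first by rewrite lt_min d0 r0.
by move=> v; rewrite lt_min => /andP[vd vr]; rewrite -fg// -fgx; exact: K.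
Qed.

Lemma fderivD X Y (f g : X -> Y) (x : X) (L M N : X -> Y) :
  fderiv f x L -> fderiv g x M -> (forall v, N v = L v + M v) ->
  fderiv (fun y => f y + g y) x N.
Proof.
move=> fL gM NE e e0; have e2 : 0 < e / 2 by rewrite divr_gt0.
have [d d0 K] := fL _ e2; have [r r0 K'] := gM _ e2.
exists (Num.min d r); first by rewrite lt_min d0 r0.
move=> v; rewrite lt_min => /andP[vd vr]; rewrite NE.
have -> : f (x + v) + g (x + v) - (f x + g x) - (L v + M v) =
  (f (x + v) - f x - L v) + (g (x + v) - g x - M v).
  by rewrite (opprD (f x)) (addrACA (f (x + v))) (opprD (L v)) [LHS]addrACA.
apply: le_trans (ler_normD _ _) _.
by apply: le_trans (lerD (K v vd) (K' v vr)) _; rewrite -mulrDl -splitr.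
Qed.

Lemma fderivN X Y (f : X -> Y) (x : X) (L N : X -> Y) :
  fderiv f x L -> (forall v, N v = - L v) -> fderiv (fun y => - f y) x N.
Proof.
move=> fL NE; apply: (small_o_le 1 ltr01 _ fL) => v _.
by rewrite NE mul1r -[leRHS]normrN !opprD.
Qed.

Lemma fderiv_post X Y Z (A : Lop Y Z) (f : X -> Y) (x : X) (L : X -> Y) :
  fderiv f x L -> fderiv (fun y => A (f y)) x (fun v => A (L v)).
Proof.
move=> fL e e0; have M0 : 0 < `|A| + 1 by rewrite ltr_wpDl.
have [d d0 K] := fL (e / (`|A| + 1)) (divr_gt0 e0 M0); exists d => // v vd.
rewrite -!LopB; apply: le_trans (ler_Lop _ _) _.
apply: (@le_trans _ _ ((`|A| + 1) * `|f (x + v) - f x - L v|)).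
  by rewrite ler_wpM2r// lerDl.
rewrite -ler_pdivlMl//; apply: le_trans (K v vd) _.
by rewrite mulrCA mulrA.
Qed.

Lemma fderiv_Lop X Y (A : Lop X Y) (x : X) : fderiv A x A.
Proof.
move=> e e0; exists 1 => // v _.
by rewrite LopD [A x + A v]addrC addrK subrr normr0 mulr_ge0// ltW.
Qed.

Lemma fderiv_cst X Y (y : Y) (x : X) : fderiv (fun _ => y) x (0 : Lop X Y).
Proof.
move=> e e0; exists 1 => // v _.
by rewrite -[X in `|X|]/(y - y - 0) subrr subr0 normr0 mulr_ge0// ltW.
Qed.

Lemma Lop_comp_subproof X Y Z (A : Lop Y Z) (B : Lop X Y) :
  (fun x => A (B x)) \in @bounded_op R X Z.
Proof.
rewrite inE; split; first by move=> a u v; rewrite !LopD !LopZ.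
exists (`|A| * `|B|) => x; apply: le_trans (ler_Lop _ _) _.
by rewrite -mulrA ler_wpM2l// ler_Lop.
Qed.

Definition Lop_comp X Y Z (A : Lop Y Z) (B : Lop X Y) : Lop X Z :=
  MkLop (Lop_comp_subproof A B).

Lemma Lop_comp_norm X Y Z (A : Lop Y Z) (B : Lop X Y) :
  `|Lop_comp A B| <= `|A| * `|B|.
Proof.
apply: Lop_norm_le => [|x]; first by rewrite mulr_ge0.
by rewrite -mulrA; apply: le_trans (ler_Lop A _) _; rewrite ler_wpM2l// ler_Lop.
Qed.

Lemma Lop_post_subproof X Y Z (A : Lop Y Z) :
  (fun B : Lop X Y => Lop_comp A B) \in @bounded_op R (Lop X Y) (Lop X Z).
Proof.
rewrite inE; split; last by exists `|A| => B; exact: Lop_comp_norm.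
move=> a B C; apply: LopP => x.
by rewrite -[LHS]/(A (a *: B x + C x)) LopD LopZ.
Qed.

Definition Lop_post X Y Z (A : Lop Y Z) : Lop (Lop X Y) (Lop X Z) :=
  MkLop (Lop_post_subproof X A).

Lemma Lop_pre_subproof X Y Z (B : Lop X Y) :
  (fun A : Lop Y Z => Lop_comp A B) \in @bounded_op R (Lop Y Z) (Lop X Z).
Proof.
rewrite inE; split; last by exists `|B| => A; rewrite mulrC Lop_comp_norm.
by move=> a A C; apply: LopP => x.
Qed.

Definition Lop_pre X Y Z (B : Lop X Y) : Lop (Lop Y Z) (Lop X Z) :=
  MkLop (Lop_pre_subproof Z B).

Lemma class_C_fderiv X Y n (W : set X) (f : X -> Y) x :
  class_C n.+1 W f -> W x -> fderiv f x (dop f x).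
Proof. by move=> [df _] Wx; apply: differentiable_fderiv; exact: df. Qed.

(** Openness of [W] makes the two maps agree near each point of [W], so that their derivatives agree
    on [W] too and the induction goes on. *)
Lemma class_C_eq X n Y (W : set X) (f g : X -> Y) :
  open W -> (forall x, W x -> f x = g x) -> class_C n W f -> class_C n W g.
Proof.
move=> oW; have near_fg Y' (f' g' : X -> Y') x :
    (forall x, W x -> f' x = g' x) -> W x -> \forall y \near x, f' y = g' y.
  by move=> fg Wx; apply: filterS fg _; exact: open_nbhs_nbhs.
elim: n Y f g => [|n IH] Y f g fg.
  move=> cf x Wx; have /continuousP_norm K := cf x Wx.
  apply/continuousP_norm => e e0; have [d d0 Kd] := K e e0.
  have /nbhsP_norm[r r0 fgr] := near_fg _ f g x fg Wx.
  exists (Num.min d r); first by rewrite lt_min d0 r0.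
  by move=> v; rewrite lt_min => /andP[vd vr]; rewrite -fgr// -fg//; exact: Kd.
move=> [df cf]; have gf x : W x -> differentiable g x /\ dop g x = dop f x.
  move=> Wx; apply: fderivP; apply: fderiv_near (near_fg _ f g x fg Wx) _.
  by apply: differentiable_fderiv; exact: df.
split; first by move=> x /gf[].
by apply: IH cf => x /gf[_ ->].
Qed.

Lemma class_CS X n Y (W : set X) (f : X -> Y) (f' : X -> Lop X Y) :
  open W -> (forall x, W x -> fderiv f x (f' x)) -> class_C n W f' ->
  class_C n.+1 W f.
Proof.
move=> oW ff' cf'; split; first by move=> x /ff'/fderivP[].
by apply: class_C_eq cf' => // x /ff'/fderivP[_ ->].
Qed.

Lemma class_C_le X n Y (W : set X) (f : X -> Y) :
  class_C n.+1 W f -> class_C n W f.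
Proof.
elim: n Y f => [|n IH] Y f [df cf]; last by split=> //; exact: IH.
by move=> x Wx; apply: differentiable_continuous; exact: df.
Qed.

Lemma class_C_continuous X n Y (W : set X) (f : X -> Y) x :
  class_C n W f -> W x -> {for x, continuous f}.
Proof.
case: n => [|n]; first exact.
by move=> [df _] Wx; apply: differentiable_continuous; exact: df.
Qed.

(** The derivative is [Lop_post X A] after [dop f], again a bounded operator after a map; the
    induction therefore runs over all [Y] and [Z]. *)
Lemma class_C_post X n Y Z (W : set X) (A : Lop Y Z) (f : X -> Y) :
  open W -> class_C n W f -> class_C n W (fun x => A (f x)).
Proof.
move=> oW; elim: n Y Z A f => [|n IH] Y Z A f.
  move=> cf x Wx; apply: (@continuous_comp _ _ _ f A); first exact: cf.
  exact: Lop_continuous.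
move=> cf; apply: (@class_CS _ _ _ _ _ (fun x => Lop_post X A (dop f x))) => //.
  by move=> x Wx; apply: fderiv_post (class_C_fderiv cf Wx).
by apply: IH; case: cf.
Qed.

Lemma class_CD X n Y (W : set X) (f g : X -> Y) :
  open W -> class_C n W f -> class_C n W g -> class_C n W (fun x => f x + g x).
Proof.
move=> oW; elim: n Y f g => [|n IH] Y f g.
  by move=> cf cg x Wx; apply: continuousD; [exact: cf|exact: cg].
move=> cf cg; apply: (@class_CS _ _ _ _ _ (fun x => dop f x + dop g x)) => //.
  by move=> x Wx; apply: fderivD (class_C_fderiv cf Wx) (class_C_fderiv cg Wx) _.
by apply: IH; [case: cf|case: cg].
Qed.

Lemma class_C_cst X n Y (W : set X) (y : Y) : open W -> class_C n W (fun _ => y).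
Proof.
move=> oW; elim: n Y y => [|n IH] Y y; first by move=> x _; exact: cvg_cst.
apply: class_CS (IH _ (0 : Lop X Y)) => // x _; exact: fderiv_cst.
Qed.

Lemma class_C_Lop X n Y (W : set X) (A : Lop X Y) : open W -> class_C n W A.
Proof.
move=> oW; case: n => [|n]; first by move=> x _; exact: Lop_continuous.
by apply: class_CS (class_C_cst n A oW) => // x _; exact: fderiv_Lop.
Qed.

End frechet_calculus.

(** * Curves in normed spaces *)

Section curves.
Context (R : realType).
Implicit Types X Y Z : normedModType R.

Lemma small_o_scale Y (f : R -> Y) (t : R) :
  {for t, continuous f} -> small_o (fun h : R => h *: (f (t + h) - f t)).
Proof.
move=> /continuousP_norm cf e e0; have [d d0 K] := cf e e0.
by exists d => // h hd; rewrite normrZ mulrC ler_wpM2r// K.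
Qed.

Lemma Lop_line_subproof X (v : X) : (fun h : R => h *: v) \in @bounded_op R R X.
Proof.
rewrite inE; split; first by move=> a h k; rewrite scalerDl scalerA.
by exists `|v| => h; rewrite normrZ mulrC.
Qed.

Definition Lop_line X (v : X) : Lop R X := MkLop (Lop_line_subproof v).

Lemma Lop_curve_subproof X : @Lop_line X \in @bounded_op R X (Lop R X).
Proof.
rewrite inE; split.
  move=> a u v; apply: LopP => h.
  by rewrite -[LHS]/(h *: (a *: u + v)) scalerDr !scalerA mulrC -scalerA.
exists 1 => v; rewrite mul1r; apply: Lop_norm_le => // h.
by rewrite -[X in `|X|]/(h *: v) normrZ mulrC.
Qed.

(** The identification of vectors with operators on the line. Being bounded, it carries the
    smoothness of a velocity over to [dop]. *)
Definition Lop_curve X : Lop X (Lop R X) := MkLop (Lop_curve_subproof X).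

Definition velocity X (f : R -> X) (t : R) (v : X) : Prop :=
  fderiv f t (Lop_line v).

Lemma velocity_continuous X (f : R -> X) t v :
  velocity f t v -> {for t, continuous f}.
Proof. exact: fderiv_continuous. Qed.

Lemma velocity_scale X (u : X) s : velocity (fun s : R => s *: u) s u.
Proof. exact: (fderiv_Lop (Lop_line u)). Qed.

Lemma velocity_line X (p u : X) s : velocity (fun s : R => p + s *: u) s u.
Proof.
by apply: fderivD (fderiv_cst p s) (velocity_scale u s) _ => h; rewrite [RHS]add0r.
Qed.

(** Product rule. The remainder is the sum of [T (t + h)] applied to the remainder of [S], the
    remainder of [T] applied to [S t], and [h] times the increment of [T] applied to [S']. The first
    is small because [T] is bounded near [t]. *)
Lemma velocity_Lop X Y (T : R -> Lop X Y) (S : R -> X) t T' S' :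
  velocity T t T' -> velocity S t S' ->
  velocity (fun t => T t (S t)) t (T' (S t) + T t S').
Proof.
move=> hT hS; have cT := velocity_continuous hT.
have [d d0 Td] : exists2 d : R, 0 < d &
    forall h, `|h| < d -> forall x, `|T (t + h) x| <= (`|T t| + 1) * `|x|.
  have /continuousP_norm/(_ _ ltr01)[d d0 K] := cT; exists d => // h hd x.
  apply: le_trans (ler_Lop _ _) _; rewrite ler_wpM2r// -lerBlDl.
  by apply: le_trans (lerB_dist _ _) _; exact: K.
have n1 : small_o (fun h => T (t + h) (S (t + h) - S t - h *: S')).
  by apply: small_o_le _ d0 _ hS => h /Td; apply.
have n2 : small_o (fun h => (T (t + h) - T t - h *: T') (S t)).
  by apply: (small_o_le `|S t| ltr01 _ hT) => h _;
    rewrite mulrC; exact: ler_Lop.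
have n3 : small_o (fun h : R => (h *: (T (t + h) - T t)) S').
  apply: (small_o_le `|S'| ltr01 _ (small_o_scale cT)).
  by move=> h _; rewrite mulrC; exact: ler_Lop.
apply: small_o_eq (small_oD (small_oD n1 n2) n3) => h /=.
rewrite -[X in _ - X]/(h *: (T' (S t) + T t S')) scalerDr.
rewrite -[X in _ = _ + X + _]/(T (t + h) (S t) - T t (S t) - h *: T' (S t)).
rewrite -[X in _ = _ + X]/(h *: (T (t + h) S' - T t S')) scalerBr.
rewrite !LopB LopZ.
set a := T _ _; set b := T t _; set c := T (t + h) (S t); set d' := h *: T' _.
set x := h *: T t _; set y := h *: T (t + h) _.
rewrite [a - c - y]addrAC -[c - b - d']addrA subrKA [a - y + _]addrAC subrKA.
by rewrite !opprD !addrA.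
Qed.

End curves.

Section smooth_curves.
Context (R : realType).
Implicit Types X Y Z : normedModType R.

(** A version of [class_C] for curves in which every derivative is a vector of the same space [X];
    [curve_C_class_C] converts back. *)
Fixpoint curve_C X (n : nat) (J : set R) (f : R -> X) {struct n} : Prop :=
  if n is n'.+1 then
    exists f' : R -> X, (forall t, J t -> velocity f t (f' t)) /\ curve_C n' J f'
  else forall t, J t -> {for t, continuous f}.

Lemma curve_C_le X n (J : set R) (f : R -> X) : curve_C n.+1 J f -> curve_C n J f.
Proof.
elim: n f => [|n IH] f [f' [hf cf]]; first by move=> t /hf/velocity_continuous.
by exists f'; split=> //; exact: IH.
Qed.

Lemma curve_C_cst X n (J : set R) (x : X) : curve_C n J (fun _ => x).
Proof.
elim: n x => [|n IH] x; first by move=> t _; exact: cvg_cst.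
exists (fun _ => 0); split; last exact: IH.
move=> t _ e e0; exists 1 => // h _.
rewrite -[Lop_line _ h]/(h *: (0 : X)) scaler0 !subr0 subrr normr0.
by rewrite mulr_ge0// ltW.
Qed.

Lemma curve_CD X n (J : set R) (f g : R -> X) :
  curve_C n J f -> curve_C n J g -> curve_C n J (fun t => f t + g t).
Proof.
elim: n f g => [|n IH] f g.
  by move=> cf cg t Jt; apply: continuousD; [exact: cf|exact: cg].
move=> [f' [hf cf]] [g' [hg cg]]; exists (fun t => f' t + g' t).
split; last exact: IH.
by move=> t Jt; apply: fderivD (hf t Jt) (hg t Jt) _ => h; exact: scalerDr.
Qed.

Lemma curve_CN X n (J : set R) (f : R -> X) :
  curve_C n J f -> curve_C n J (fun t => - f t).
Proof.
elim: n f => [|n IH] f; first by move=> cf t Jt; apply: continuousN; exact: cf.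
move=> [f' [hf cf]]; exists (fun t => - f' t); split; last exact: IH.
by move=> t Jt; apply: fderivN (hf t Jt) _ => h; exact: scalerN.
Qed.

Lemma curve_C_post X Y n (J : set R) (A : Lop X Y) (f : R -> X) :
  curve_C n J f -> curve_C n J (fun t => A (f t)).
Proof.
elim: n f => [|n IH] f.
  move=> cf t Jt; apply: (@continuous_comp _ _ _ f A); first exact: cf.
  exact: Lop_continuous.
move=> [f' [hf cf]]; exists (fun t => A (f' t)); split; last exact: IH.
move=> t Jt; apply: small_o_eq (fderiv_post A (hf t Jt)) => h.
by rewrite -[Lop_line (A _) h]/(h *: A (f' t)) -LopZ.
Qed.

Lemma continuous_Lop_app X Y (T : R -> Lop X Y) (S : R -> X) t :
  {for t, continuous T} -> {for t, continuous S} ->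
  {for t, continuous (fun t => T t (S t))}.
Proof.
move=> cT cS; apply/cvgrPdist_le => e e0.
have e2 : 0 < e / 2 by rewrite divr_gt0.
have M0 : 0 < `|T t| + 1 by rewrite ltr_wpDl.
have N0 : 0 < `|S t| + 1 by rewrite ltr_wpDl.
near=> s.
have -> : T t (S t) - T s (S s) = T t (S t - S s) + (T t - T s) (S s).
  by rewrite LopB -[(T t - T s) (S s)]/(T t (S s) - T s (S s)) subrKA.
apply: le_trans (ler_normD _ _) _; rewrite [leRHS]splitr.
apply: lerD; apply: le_trans (ler_Lop _ _) _.
  apply: (@le_trans _ _ ((`|T t| + 1) * `|S t - S s|)).
    by rewrite ler_wpM2r// lerDl.
  rewrite -ler_pdivlMl//; near: s.
  by move/cvgrPdist_le: cS; apply; rewrite mulr_gt0// ?invr_gt0.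
rewrite mulrC; apply: (@le_trans _ _ ((`|S t| + 1) * `|T t - T s|)).
  rewrite ler_wpM2r// -lerBlDl; apply: le_trans (lerB_dist _ _) _.
  by rewrite distrC; near: s; move/cvgrPdist_le: cS; apply.
rewrite -ler_pdivlMl//; near: s.
by move/cvgrPdist_le: cT; apply; rewrite mulr_gt0// ?invr_gt0.
Unshelve. all: by end_near. Qed.

Lemma curve_C_app X Y n (J : set R) (T : R -> Lop X Y) (S : R -> X) :
  curve_C n J T -> curve_C n J S -> curve_C n J (fun t => T t (S t)).
Proof.
elim: n T S => [|n IH] T S.
  by move=> cT cS t Jt; apply: continuous_Lop_app; [exact: cT|exact: cS].
move=> cT cS; have [cT' cS'] := (curve_C_le cT, curve_C_le cS).
case: cT cS => [T' [hT cT]] [S' [hS cS]].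
exists (fun t => T' t (S t) + T t (S' t)); split.
  by move=> t Jt; exact: velocity_Lop (hT t Jt) (hS t Jt).
by apply: curve_CD; exact: IH.
Qed.

Lemma velocity_comp X Y (F : X -> Y) (g : R -> X) (L : Lop X Y) t g' :
  fderiv F (g t) L -> velocity g t g' ->
  velocity (fun t => F (g t)) t (L g').
Proof.
move=> /fderivP[dF FL] /fderivP[dg gL].
have dFg : differentiable (F \o g) t by exact: differentiable_comp.
have := differentiable_fderiv dFg.
have -> // : (dop (F \o g) t : R -> Y) = Lop_line (L g').
by rewrite dopE// diff_comp// -!dopE// FL gL; apply/funext => h; exact: LopZ.
Qed.

(** The velocity [dop F (g t) (g' t)] is an operator curve applied to a vector curve, so
    [curve_C_app] reduces the claim to [dop F], of one class less and with another target. *)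
Lemma curve_C_comp X n Y (W : set X) (J : set R) (F : X -> Y) (g : R -> X) :
  class_C n W F -> (forall t, J t -> W (g t)) -> curve_C n J g ->
  curve_C n J (fun t => F (g t)).
Proof.
move=> + gW; elim: n Y F g gW => [|n IH] Y F g gW.
  move=> cF cg t Jt; apply: (@continuous_comp _ _ _ g F); first exact: cg.
  by apply: cF; exact: gW.
move=> cF cg; have cg' := curve_C_le cg; case: cg => [g' [hg cg]].
exists (fun t => dop F (g t) (g' t)); split.
  by move=> t Jt; apply: velocity_comp (hg t Jt); apply: class_C_fderiv cF _; exact: gW.
by apply: curve_C_app => //; apply: IH => //; case: cF.
Qed.

Lemma curve_C_class_C X n (J : set R) (f : R -> X) :
  open J -> curve_C n J f -> class_C n J f.
Proof.
move=> oJ; elim: n X f => [//|n IH] X f [f' [hf cf]].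
apply: (@class_CS _ _ _ _ _ _ (fun t => Lop_line (f' t))) => //.
by apply: IH; exact: (curve_C_post (Lop_curve X) cf).
Qed.

Lemma open_normP X (W : set X) x : open W -> W x ->
  exists2 d : R, 0 < d & forall v, `|v| < d -> W (x + v).
Proof. by move=> oW Wx; apply/nbhsP_norm; exact: open_nbhs_nbhs. Qed.

(* Differentiating [T t (S t) = e t] gives an equation of the same form for the
   derivative of [S], so no smoothness of the inverse operators is needed. *)
Lemma curve_C_solve X Y n (J : set R) (K : R) (T : R -> Lop X Y)
    (e : R -> Y) (S : R -> X) :
  open J -> (forall t v, J t -> `|v| <= K * `|T t v|) ->
  (forall t y, J t -> exists v, T t v = y) ->
  (forall t, J t -> T t (S t) = e t) ->
  curve_C n J T -> curve_C n J e -> curve_C n J S.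
Proof.
move=> oJ TK Tsurj; elim: n e S => [|n IH] e S TS.
  move=> cT ce t Jt.
  have K1 : 0 < `|K| + 1 by rewrite ltr_wpDl.
  (* This function vanishes at [t], and at [t + h] it equals [T (t + h) (S (t + h) - S t)], from
     which the lower bound [TK] recovers the increment of [S]. *)
  have cf : {for t, continuous (fun s => e s - T s (S t))}.
    apply: continuousB; first exact: ce.
    by apply: continuous_Lop_app; [exact: cT|exact: cvg_cst].
  have [d0 d00 KJ] := open_normP oJ Jt.
  apply/continuousP_norm => eps eps0.
  have /continuousP_norm/(_ (eps / (`|K| + 1))) := cf.
  rewrite divr_gt0// => /(_ isT)[d d0' Kd].
  exists (Num.min d d0); first by rewrite lt_min d0'.
  move=> h; rewrite lt_min => /andP[hd hd0]; have Jh := KJ h hd0.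
  apply: le_trans (TK _ _ Jh) _.
  apply: (@le_trans _ _ ((`|K| + 1) * `|T (t + h) (S (t + h) - S t)|)).
    by rewrite ler_wpM2r// (le_trans (ler_norm K))// lerDl.
  rewrite -ler_pdivlMl// mulrC; have := Kd h hd.
  by rewrite LopB !TS// subrr subr0.
move=> cT ce; have cT' := curve_C_le cT; have ce' := curve_C_le ce.
have cS : curve_C n J S by exact: IH cT' ce'.
case: cT ce => [T' [hT cT]] [e' [he ce]].
have /choice [S' TS'] : forall t, exists v, J t -> T t v = e' t - T' t (S t).
  move=> t; have [Jt|nJ] := pselect (J t); last by exists 0.
  by have [v <-] := Tsurj t (e' t - T' t (S t)) Jt; exists v.
exists S'; split; last first.
  apply: (IH (fun t => e' t - T' t (S t))) => //.
  by apply: curve_CD => //; apply: curve_CN; exact: curve_C_app.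
move=> t Jt; have [d d0 KJ] := open_normP oJ Jt.
have cTt := velocity_continuous (hT t Jt).
(* [T (t + h)] applied to the remainder of [S] equals the remainder of [e] plus the terms of [n2]
   and [n3]; [TK] then bounds the remainder of [S] itself. *)
have n2 : small_o (fun h => - (T (t + h) - T t - h *: T' t) (S t)).
  apply: (small_o_le `|S t| ltr01 _ (hT t Jt)) => h _.
  by rewrite normrN mulrC; exact: ler_Lop.
have n3 : small_o (fun h : R => - (h *: (T (t + h) - T t)) (S' t)).
  apply: (small_o_le `|S' t| ltr01 _ (small_o_scale cTt)).
  by move=> h _; rewrite normrN mulrC; exact: ler_Lop.
apply: (small_o_le _ d0) (small_oD (small_oD (he t Jt) n2) n3) => h hd.
apply: le_trans (TK _ _ (KJ h hd)) _; have Jh := KJ h hd.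
rewrite le_eqVlt; apply/orP; left; apply/eqP; congr (_ * `|_|).
rewrite -[X in T _ (_ - X)]/(h *: S' t) !LopB LopZ TS//.
rewrite -[X in _ = _ - X + _ + _]/(h *: e' t).
rewrite -[X in _ = _ - X + _]/(T (t + h) (S t) - T t (S t) - h *: T' t (S t)).
rewrite -[X in _ = _ - X]/(h *: (T (t + h) (S' t) - T t (S' t))).
rewrite TS// TS'// !scalerBr !(opprD, opprK) !addrA.
by rewrite [RHS](ACl (1*4*7*(2*5)*(3*8)*(6*9)))%AC/= !addNr subrr !addr0.
Qed.

End smooth_curves.

(** * The inverse function theorem along a line *)

Section inverse_function.
Context (R : realType).
Implicit Types X Y Z : normedModType R.

(** A vector-valued map has no intermediate point, so the bound [(M + e) * s] is propagated from
    [0]. At the supremum [c] of the reachable parameters, the slack [e] absorbs the remainder of [f]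
    and carries the bound past [c] unless [c = 1]. *)
Lemma mean_value_unit Y (f f' : R -> Y) (M : R) :
  (forall t, 0 <= t <= 1 -> velocity f t (f' t)) ->
  (forall t, 0 <= t <= 1 -> `|f' t| <= M) -> `|f 1 - f 0| <= M.
Proof.
move=> hf f'M; apply/ler_addgt0Pr => e e0.
have step c : 0 <= c <= 1 -> exists2 d : R, 0 < d &
    forall h, `|h| < d -> `|f (c + h) - f c| <= (M + e) * `|h|.
  move=> c01; have [d d0 K] := hf c c01 e e0; exists d => // h hd.
  rewrite -[_ - _](subrK (h *: f' c)); apply: le_trans (ler_normD _ _) _.
  rewrite mulrDl addrC; apply: lerD; last exact: K.
  by rewrite normrZ mulrC ler_wpM2r// f'M.
pose A := [set t : R | 0 <= t <= 1 /\
  forall s, 0 <= s <= t -> `|f s - f 0| <= (M + e) * s].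
have A0 : A 0.
  split; first by rewrite lexx ler01.
  by move=> s s0; rewrite (@le_anti _ _ s 0) 1?andbC// subrr normr0 mulr0.
have A1 : ubound A 1 by move=> t [/andP[]].
have supA : has_sup A by split; [exists 0|exists 1].
pose c := sup A.
have c0 : 0 <= c by exact: ub_le_sup supA.2 _ A0.
have c1 : c <= 1 by apply: ge_sup supA.1 A1.
have c01 : 0 <= c <= 1 by rewrite c0.
have [d d0 K] := step c c01.
have Ac : A c.
  split=> // s /andP[s0 sc].
  have below t : A t -> s <= t -> `|f s - f 0| <= (M + e) * s.
    by move=> [_ At] st; apply: At; rewrite s0.
  have [{}sc|cs] := ltP s c.
    have cs0 : 0 < c - s by rewrite subr_gt0.
    have [t At st] := sup_adherent cs0 supA.
    by apply: (below t At); rewrite -/c subKr in st; exact: ltW.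
  have {sc cs} -> : s = c by apply/le_anti; rewrite sc.
  have [t At tc] := sup_adherent d0 supA.
  have tlec : t <= c by exact: ub_le_sup supA.2 _ At.
  have ct : `|t - c| = c - t by rewrite distrC ger0_norm// subr_ge0.
  have := K (t - c); rewrite ct (addrC c (t - c)) subrK => Kt.
  rewrite -[f c](subrK (f t)) -addrA; apply: le_trans (ler_normD _ _) _.
  rewrite -{2}[c](subrK t) mulrDr; apply: lerD.
    by rewrite distrC; apply: Kt; rewrite ltrBlDl -ltrBlDr.
  by apply: At.2; rewrite lexx; case/andP: At.1 => ->.
have [cl1|c1'] := ltP c 1; last first.
  have cE : c = 1 by apply/le_anti; rewrite c1.
  by rewrite -[leRHS]mulr1; apply: Ac.2; rewrite cE ler01 lexx.
pose h := Num.min (d / 2) (1 - c).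
have h0 : 0 < h by rewrite lt_min divr_gt0// subr_gt0.
suff /(ub_le_sup supA.2) : A (c + h) by rewrite gerDl leNgt h0.
split; first by rewrite addr_ge0 ?(ltW h0)//= -lerBrDl ge_min lexx orbT.
move=> s /andP[s0 sh]; have [sc|cs] := leP s c; first by apply: Ac.2; rewrite s0.
have sc0 : 0 <= s - c by rewrite subr_ge0 ltW.
have := K (s - c); rewrite ger0_norm// (addrC c (s - c)) subrK => Ks.
rewrite -[f s](subrK (f c)) -addrA; apply: le_trans (ler_normD _ _) _.
rewrite -{2}[s](subrK c) mulrDr; apply: lerD; last by apply: Ac.2; rewrite c0 lexx.
apply: Ks; apply: (@le_lt_trans _ _ (d / 2)); last by rewrite ltr_pdivrMr// ltr_pMr// ltr1n.
by rewrite lerBlDl; apply: le_trans sh _; rewrite lerD2l ge_min lexx.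
Qed.

(** The mean value bound for [F - T] on the segment from [z'] to [z], which stays in the ball by
    convexity. *)
Lemma mean_value_ball X Y (F : X -> Y) (F' : X -> Lop X Y) (T : Lop X Y)
    (p : X) (r eta : R) :
  (forall z, `|z - p| <= r -> fderiv F z (F' z) /\ `|F' z - T| <= eta) ->
  forall z z', `|z - p| <= r -> `|z' - p| <= r ->
  `|F z - F z' - T (z - z')| <= eta * `|z - z'|.
Proof.
move=> FT z z' zr z'r; pose g (s : R) := z' + s *: (z - z').
have gr s : 0 <= s <= 1 -> `|g s - p| <= r.
  move=> /andP[s0 s1].
  have -> : g s - p = (1 - s) *: (z' - p) + s *: (z - p).
    rewrite /g scalerBl scale1r !scalerBr !(opprD, opprK) !addrA.
    by rewrite [RHS](ACl (1*5*3*2*(4*6)))%AC/= subrr addr0.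
  apply: le_trans (ler_normD _ _) _.
  rewrite !normrZ (ger0_norm s0) ger0_norm ?subr_ge0//.
  rewrite [leRHS](_ : r = (1 - s) * r + s * r); last by ring.
  by apply: lerD; rewrite ler_wpM2l// subr_ge0.
have vg s : velocity g s (z - z') by exact: velocity_line.
pose f s := F (g s) + (- T) (g s).
have := @mean_value_unit _ f (fun s => (F' (g s) - T) (z - z')) (eta * `|z - z'|).
have -> : f 1 - f 0 = F z - F z' - T (z - z').
  rewrite /f /g scale1r scale0r addr0 [z' + (z - z')]addrC subrK LopB.
  rewrite -[(- T) z]/(- T z) -[(- T) z']/(- T z').
  by rewrite opprD opprK addrACA opprB [T z' - T z]addrC.
apply.
  move=> s s01; have [Fs _] := FT _ (gr s s01).
  have vF := velocity_comp Fs (vg s).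
  apply: fderivD vF (velocity_comp (fderiv_Lop (- T) (g s)) (vg s)) _ => h.
  exact: scalerDr.
move=> s s01; have [_ Fs] := FT _ (gr s s01).
by apply: le_trans (ler_Lop _ _) _; rewrite ler_wpM2r.
Qed.

Definition cauchy_complete X : Prop := forall u : nat -> X,
  (forall e : R, 0 < e -> exists N, forall m n, (N <= m)%N -> (N <= n)%N ->
     `|u m - u n| <= e) ->
  exists l : X, forall e : R, 0 < e -> exists N, forall n, (N <= n)%N ->
     `|u n - l| <= e.

Lemma half_expn_small (r e : R) : 0 < e -> exists N, forall n, (N <= n)%N ->
  2^-1 ^+ n * r <= e.
Proof.
move=> e0; exists (Num.bound `|r / e|) => n Nn.
rewrite exprVn ler_pdivrMl ?exprn_gt0// -ler_pdivrMr//.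
apply: le_trans (ler_norm _) _; apply: le_trans (ltW (archi_boundP _)) _ => //.
rewrite -natrX ler_nat; apply: leq_trans Nn _; exact/ltnW/ltn_expl.
Qed.

(** [N] need not map into the ball by assumption: an iterate moves at most [r / 2] away from [N p],
    which lies within [r / 2] of [p]. The ball is closed, so the limit stays in it. *)
Lemma contraction_fixed_point X (N : X -> X) (p : X) (r : R) :
  cauchy_complete X -> 0 <= r ->
  (forall z z', `|z - p| <= r -> `|z' - p| <= r ->
     `|N z - N z'| <= 2^-1 * `|z - z'|) ->
  `|N p - p| <= 2^-1 * r -> exists2 z, `|z - p| <= r & N z = z.
Proof.
move=> cX r0 NK Np; pose u n := iter n N p.
have h0 : 0 <= 2^-1 :> R by rewrite invr_ge0.
have ur n : `|u n - p| <= r.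
  elim: n => [|n IH]; first by rewrite subrr normr0.
  rewrite -(subrK (N p) (u n.+1)) -addrA; apply: le_trans (ler_normD _ _) _.
  have -> : r = 2^-1 * r + 2^-1 * r by field.
  apply: lerD => //; apply: le_trans (NK _ _ IH _) _; rewrite ?subrr ?normr0//.
  by rewrite ler_wpM2l.
have uD n k : `|u (n + k)%N - u n| <= 2^-1 ^+ n * r.
  elim: n k => [|n IH] k; first by rewrite mul1r ur.
  rewrite addSn exprS -mulrA; apply: le_trans (NK _ _ (ur _) (ur _)) _.
  by rewrite ler_wpM2l.
have [|l ul] := cX u.
  move=> e e0; have e2 : 0 < e / 2 by rewrite divr_gt0.
  have [M MK] := half_expn_small r e2; exists M => m n Mm Mn.
  rewrite -(subrK (u M) (u m)) -addrA [leRHS]splitr.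
  apply: le_trans (ler_normD _ _) _; apply: lerD; last rewrite distrC.
    by rewrite -(subnKC Mm); apply: le_trans (uD _ _) (MK _ (leqnn _)).
  by rewrite -(subnKC Mn); apply: le_trans (uD _ _) (MK _ (leqnn _)).
have lr : `|l - p| <= r.
  apply/ler_addgt0Pr => e e0; have [M MK] := ul e e0.
  rewrite -(subrK (u M) l) -addrA; apply: le_trans (ler_normD _ _) _.
  by rewrite (addrC r e) lerD// distrC MK.
exists l => //; apply/subr0_eq/eqP; rewrite -normr_le0; apply/ler_addgt0Pr => e e0.
rewrite add0r; have e2 : 0 < e / 2 by rewrite divr_gt0.
have [M MK] := ul _ e2.
rewrite -(subrK (u M.+1) (N l)) -addrA; apply: le_trans (ler_normD _ _) _.
rewrite [leRHS]splitr; apply: lerD; last exact: MK.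
apply: le_trans (NK _ _ lr (ur _)) _; apply: (@le_trans _ _ `|l - u M|).
  by rewrite ler_piMl// invf_le1// ler1n.
by rewrite distrC MK.
Qed.

End inverse_function.

Section inverse_curve.
Context (R : realType).
Implicit Types X Y Z : normedModType R.

Lemma approx_surjective X Y (S0 : Lop Y X) (T : X -> Y) (p : X) (y : Y) (r : R) :
  cauchy_complete X -> (forall y, S0 y = 0 -> y = 0) -> 0 <= r ->
  (forall z z', `|z - p| <= r -> `|z' - p| <= r ->
     `|z - z' - S0 (T z - T z')| <= 2^-1 * `|z - z'|) ->
  `|S0 (y - T p)| <= 2^-1 * r ->
  exists2 z, `|z - p| <= r & T z = y.
Proof.
move=> cX S0i r0 ST yp.
have [||z zr zE] := @contraction_fixed_point _ X (fun z => z - S0 (T z - y)) p r cX r0.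
- move=> z z' zr z'r; have := ST z z' zr z'r; congr (`|_| <= _).
  rewrite !LopB !(opprD, opprK) !addrA.
  by rewrite [RHS](ACl (1*4*2*5*(3*6)))%AC/= subrr addr0.
- by rewrite addrC addKr -LopN opprB.
exists z => //; apply/subr0_eq/S0i/eqP; rewrite -oppr_eq0; apply/eqP.
by apply: (addrI z); rewrite addr0.
Qed.

(* Solves [G z = G p + t *: e] by iterating the contraction
   [z - S0 (G z - G p - t *: e)], [S0] being the inverse of [dop G p]. *)
Theorem inverse_curve X Y n (W : set X) (G : X -> Y) (p : X) (e : Y) :
  cauchy_complete X -> open W -> W p -> class_C n.+1 W G ->
  isomorphism (dop G p) -> e != 0 ->
  exists (r eps : R) (g : R -> X), let J := `]- eps, eps[%classic : set R in
  [/\ 0 < r, 0 < eps & g 0 = p] /\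
  [/\ curve_C n.+1 J g,
      forall t, J t -> exists2 v, velocity g t v & v != 0,
      forall t, J t -> [/\ W (g t), `|g t - p| < r & G (g t) = G p + t *: e] &
      forall z z', `|z - p| < r -> `|z' - p| < r -> G z = G z' -> z = z'].
Proof.
move=> cX oW Wp cG [S0 [TK SK]] e0.
have dG z : W z -> fderiv G z (dop G z) by move=> Wz; exact: class_C_fderiv cG Wz.
set T := dop G p in TK SK *; pose K : R := `|S0| + 1.
have K0 : 0 < K by rewrite ltr_wpDl.
have SK_le y : `|S0 y| <= K * `|y|.
  by apply: le_trans (ler_Lop _ _) _; rewrite ler_wpM2r// lerDl.
(* Chosen so that [K * eta] is the contraction factor one half. *)
pose eta := (2 * K)^-1; have eta0 : 0 < eta by rewrite invr_gt0 mulr_gt0.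
have Keta : K * eta = 2^-1 by rewrite /eta; field; rewrite gt_eqF.
have [r1 r10 TT] : exists2 d : R, 0 < d &
    forall v, `|v| < d -> `|dop G (p + v) - T| <= eta.
  have cT : {for p, continuous (dop G)}.
    by case: cG => _ cG; exact: class_C_continuous cG Wp.
  by have /continuousP_norm := cT; apply.
have [r2 r20 Wr] := open_normP oW Wp.
pose r := Num.min r1 r2 / 2.
have r0 : 0 < r by rewrite divr_gt0// lt_min r10.
have rr : r < Num.min r1 r2 by rewrite /r ltr_pdivrMr// ltr_pMr ?ltr1n// lt_min r10.
have rW z : `|z - p| <= r -> W z /\ `|dop G z - T| <= eta.
  move=> /le_lt_trans/(_ rr); rewrite lt_min => /andP[zr1 zr2].
  by rewrite -(subrK p z) addrC; split; [exact: Wr|exact: TT].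
(* Since [z - z' = S0 (T (z - z'))], the left side is [S0] of the linearisation error of [G]. *)
have GT z z' : `|z - p| <= r -> `|z' - p| <= r ->
    `|z - z' - S0 (G z - G z')| <= 2^-1 * `|z - z'|.
  move=> zr z'r; rewrite -[X in X - _]TK -LopB -normrN -LopN opprB -Keta -mulrA.
  apply: le_trans (SK_le _) _; rewrite ler_wpM2l ?(ltW K0)//.
  apply: (mean_value_ball (F' := dop G)) zr z'r => w wr; have [Ww Tw] := rW w wr.
  by split=> //; exact: dG.
have lip z z' : `|z - p| <= r -> `|z' - p| <= r ->
    `|z - z'| <= 2 * K * `|G z - G z'|.
  move=> zr z'r; have := GT z z' zr z'r; have := SK_le (G z - G z').
  have := lerB_dist (z - z') (S0 (G z - G z')).
  move: `|z - z'| `|S0 _| `|_ - S0 _| `|G _ - _| => a b c d.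
  lra.
have TzK z v : `|z - p| <= r -> `|v| <= 2 * K * `|dop G z v|.
  move=> /rW[_ Tz].
  have : `|S0 (T v - dop G z v)| <= 2^-1 * `|v|.
    apply: le_trans (SK_le _) _; rewrite -Keta -mulrA ler_wpM2l ?(ltW K0)//.
    rewrite distrC -[_ - T v]/((dop G z - T) v).
    by apply: le_trans (ler_Lop _ _) _; rewrite ler_wpM2r.
  rewrite LopB TK; have := SK_le (dop G z v).
  have := lerB_dist v (S0 (dop G z v)).
  move: `|v| `|S0 _| `|_ - S0 _| `|dop _ _ _| => a b c d.
  lra.
have S0i y : S0 y = 0 -> y = 0 by move=> Sy; rewrite -(SK y) Sy Lop0.
have Tsurj z y : `|z - p| <= r -> exists v, dop G z v = y.
  move=> /rW[_ Tz].
  (* The linear map [dop G z] satisfies the contraction bound on the whole space, so the radius is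
     free; twice the first Newton step meets the starting condition. *)
  have [|||v _ <-] := @approx_surjective _ _ S0 (dop G z) 0 y (2 * `|S0 y|) cX S0i.
  - by rewrite mulr_ge0.
  - move=> v w _ _; rewrite -LopB -{1}(TK (v - w)) -LopB.
    apply: le_trans (SK_le _) _; rewrite -Keta -mulrA ler_wpM2l ?(ltW K0)//.
    rewrite distrC -[_ - T _]/((dop G z - T) (v - w)).
    by apply: le_trans (ler_Lop _ _) _; rewrite ler_wpM2r.
  - by rewrite Lop0 subr0 mulrA mulVf// mul1r.
  by exists v.
(* Then the first Newton step [S0 (t *: e)] is shorter than [r / 4], which gives a solution in the
   ball of radius [r / 2], strictly inside the ball of uniqueness. *)
pose eps := r / (4 * K * `|e|).
have ne0 : 0 < `|e| by rewrite normr_gt0.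
have eps0 : 0 < eps by rewrite divr_gt0// !mulr_gt0.
pose J := `]- eps, eps[%classic : set R.
have JP t : J t -> `|t| < eps by rewrite /J /= in_itv /= ltr_norml.
have /choice[g gP] : forall t, exists z, J t -> `|z - p| <= r / 2 /\ G z = G p + t *: e.
  move=> t; have [Jt|nJ] := pselect (J t); last by exists 0.
  have [|||z zr zG] := @approx_surjective _ _ S0 G p (G p + t *: e) (r / 2) cX S0i.
  - by rewrite divr_ge0// ltW.
  - have r2r : r / 2 <= r by rewrite ler_pdivrMr// ler_pMr// ler1n.
    by move=> z z' zr z'r; apply: GT; apply: le_trans r2r.
  - rewrite addrC addKr; apply: le_trans (SK_le _) _; rewrite normrZ.
    have := JP t Jt; rewrite /eps ltr_pdivlMr; last by rewrite !mulr_gt0.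
    move: `|t| `|e| => a b; nra.
  by exists z.
have rr2 : r / 2 < r by rewrite ltr_pdivrMr// ltr_pMr// ltr1n.
have gr t : J t -> `|g t - p| <= r.
  by move=> /gP[gr _]; apply: le_trans gr (ltW rr2).
have oJ : open J by exact: interval_open.
have J0 : J 0 by rewrite /J /= in_itv /= oppr_lt0 eps0.
have gG t : J t -> G (g t) = G p + t *: e by move=> /gP[].
have inj z z' : `|z - p| <= r -> `|z' - p| <= r -> G z = G z' -> z = z'.
  move=> zr z'r GG; apply/subr0_eq/eqP; rewrite -normr_le0.
  by apply: le_trans (lip _ _ zr z'r) _; rewrite GG subrr normr0 mulr0.
have g0 : g 0 = p.
  by apply: inj; rewrite ?subrr ?normr0 ?(ltW r0)// ?gG// ?scale0r ?addr0//; exact: gr.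
have glip s t : J s -> J t -> `|g s - g t| <= 2 * K * `|e| * `|s - t|.
  move=> Js Jt; apply: le_trans (lip _ _ (gr s Js) (gr t Jt)) _.
  by rewrite !gG// opprD addrACA subrr add0r -scalerBl normrZ (mulrC `|s - t|) mulrA.
have L0 : 0 < 2 * K * `|e| by rewrite !mulr_gt0.
have /choice[w wP] : forall t, exists v, J t -> dop G (g t) v = e.
  move=> t; have [Jt|nJ] := pselect (J t); last by exists 0.
  by have [v <-] := Tsurj (g t) e (gr t Jt); exists v.
have gw t : J t -> velocity g t (w t).
  move=> Jt; have [d d0 KJ] := open_normP oJ Jt.
  move=> eps' eps'0.
  (* The tolerance is divided by the Lipschitz constant of [g] from [glip] and by the constant
     [2 * K] lost when [dop G (g t)] is inverted through [TzK]. *)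
  have c0 : 0 < eps' / (2 * K * (2 * K * `|e|)) by rewrite divr_gt0// !mulr_gt0.
  have [d' d'0 GK] := dG (g t) (rW _ (gr t Jt)).1 _ c0.
  exists (Num.min d (d' / (2 * K * `|e|))).
    by rewrite lt_min d0 divr_gt0.
  move=> h; rewrite lt_min => /andP[hd hd']; have Jh := KJ h hd.
  have := glip _ _ Jh Jt; rewrite (addrC t) addrK (addrC h) => gh.
  have ghd : `|g (t + h) - g t| < d'.
    by apply: le_lt_trans gh _; rewrite -ltr_pdivlMl// mulrC.
  rewrite -[Lop_line _ h]/(h *: w t).
  apply: le_trans (TzK _ _ (gr t Jt)) _; rewrite (LopB _ (_ - _)) LopZ wP//.
  have := GK _ ghd; rewrite (addrC (g t)) subrK !gG//.
  rewrite scalerDl addrA [G p + _ + _]addrC addrK distrC => GKh.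
  apply: (@le_trans _ _ (2 * K * (eps' / (2 * K * (2 * K * `|e|)) *
    (2 * K * `|e| * `|h|)))).
    rewrite ler_wpM2l ?mulr_ge0 ?(ltW K0)//; apply: le_trans GKh _.
    by rewrite ler_wpM2l// ltW.
  rewrite le_eqVlt; apply/orP; left; apply/eqP; field.
  by rewrite !gt_eqF.
(* Bootstrap: if [g] has class [m], so have the coefficients [dop G (g t)], hence also the solution
   [w] of the linear equation, and [w] is the velocity of [g]. *)
have cg : curve_C n.+1 J g.
  have step m : class_C m.+1 W G -> curve_C m J g -> curve_C m.+1 J g.
    move=> [_ cG'] cg; exists w; split=> //.
    apply: (@curve_C_solve _ X Y m J (2 * K) (fun t => dop G (g t)) (fun _ => e)) => //.
    - by move=> t v Jt; apply: TzK; exact: gr.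
    - by move=> t y Jt; apply: Tsurj; exact: gr.
    - by apply: (@curve_C_comp _ X m _ W) => // t /gr/rW[].
    - exact: curve_C_cst.
  elim: n cG => [|n IH] cG; apply: step => //; first by move=> t /gw/velocity_continuous.
  exact/IH/class_C_le.
exists r, eps, g; split=> //; split=> //.
- move=> t Jt; exists (w t); first exact: gw.
  by apply: contra_neq e0 => wt; rewrite -(wP t Jt) wt Lop0.
- move=> t Jt; split; first by have [] := rW _ (gr t Jt).
    by apply: le_lt_trans rr2; have [] := gP t Jt.
  exact: gG.
by move=> z z' zr z'r; apply: inj; exact: ltW.
Qed.

End inverse_curve.

(** * Completeness of the space of displacements *)

Section completeness.
Context (R : realType).

Lemma real_cauchy_cvg (u : nat -> R) :
  (forall e : R, 0 < e -> exists N, forall m n, (N <= m)%N -> (N <= n)%N ->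
     `|u m - u n| <= e) ->
  exists l : R, u n @[n --> \oo] --> l.
Proof.
move=> cu; apply/cvg_ex/cauchy_cvgP/cauchy_exP => e e0.
have e2 : 0 < e / 2 by rewrite divr_gt0.
have [N uN] := cu _ e2; exists (u N); exists N => // n /= Nn.
rewrite -ball_normE /=; apply: le_lt_trans (uN _ _ (leqnn _) Nn) _.
by rewrite ltr_pdivrMr// ltr_pMr// ltr1n.
Qed.

Lemma Dt_le_norm (v : H1 R) m rho : rho \in nn -> `|Dt v m rho| <= `|v|.
Proof.
move=> rhonn; rewrite -(@ler_pXn2r _ 2)// ?nnegrE// real_normK ?num_real//.
have := @sum_Dt_sq_le_norm _ v [set m] (finite_set1 m).
rewrite fsbig_set1; apply: le_trans; rewrite /Dt_sq.
by rewrite (big_rem rho)//= lerDl sumr_ge0// => r _; rewrite sqr_ge0.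
Qed.

Lemma H1_hor (v : H1 R) (a b : int) : `|v (a + 1, b) - v (a, b)| <= `|v|.
Proof.
have := @Dt_le_norm v (a, b) e1 isT; rewrite /Dt /D mem_filter !andbF/=.
by congr (`|disp v _ - _| <= _); congr pair; rewrite addr0.
Qed.

Lemma H1_ver (v : H1 R) (b : int) : `|v (1, b + 1) - v (1, b)| <= `|v|.
Proof.
have := @Dt_le_norm v (1, b) e2 isT.
rewrite /Dt /D mem_filter Gamma_minusE/= !andbF/=.
by congr (`|disp v _ - _| <= _); congr pair; rewrite addr0.
Qed.

Lemma int_shift_ind (P : int -> Prop) (b0 : int) : P b0 ->
  (forall b, P b -> P (b + 1)) -> (forall b, P (b + 1) -> P b) -> forall b, P b.
Proof.
move=> Pb0 up down b.
have upn (n : nat) : P (b0 + n%:Z).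
  elim: n => [|n /up]; first by rewrite addr0.
  by rewrite -addrA -PoszD addn1.
have downn (n : nat) : P (b0 - n%:Z).
  elim: n => [|n IH]; first by rewrite subr0.
  by apply: down; rewrite [X in P X](_ : _ = b0 - n%:Z)//; lia.
have [bb|bb] := leP b0 b.
  by have := upn `|b - b0|%N; congr P; lia.
by have := downn `|b0 - b|%N; congr P; lia.
Qed.

(** A walk over uncut bonds from the pinned site [(1, 1)] to [m], each adding one to the constant:
    vertically in column [1], which lies to the right of the crack, then along the row, whose bonds
    are never cut. *)
Lemma H1_eval_bounded (m : lattice) :
  exists2 C : R, 0 <= C & forall v : H1 R, `|v m| <= C * `|v|.
Proof.
pose bdd m := exists2 C : R, 0 <= C & forall v : H1 R, `|v m| <= C * `|v|.
have step m1 m2 : (forall v : H1 R, `|v m1 - v m2| <= `|v|) -> bdd m2 -> bdd m1.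
  move=> h [C C0 vC]; exists (C + 1) => [|v]; first by rewrite addr_ge0.
  rewrite -(subrK (v m2) (v m1)) addrC mulrDl mul1r.
  by apply: le_trans (ler_normD _ _) _; apply: lerD.
have step' m1 m2 : (forall v : H1 R, `|v m1 - v m2| <= `|v|) -> bdd m1 -> bdd m2.
  by move=> h; apply: step => v; rewrite distrC.
have b0 : bdd (1, 1).
  by exists 0 => // v; rewrite H1_pin normr0 mul0r.
have ver (b : int) : bdd (1, b).
  apply: (@int_shift_ind (fun b => bdd (1, b)) 1) => // {}b; [apply: step|apply: step'];
  by move=> v; exact: H1_ver.
case: m => a b.
apply: (@int_shift_ind (fun a => bdd (a, b)) 1) => // {}a; [apply: step|apply: step'];
by move=> v; exact: H1_hor.
Qed.

Lemma cvg_sum_Dt_sq (w : nat -> lattice -> R) (l : lattice -> R) (A : set lattice) :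
  finite_set A -> (forall m, w n m @[n --> \oo] --> l m) ->
  \sum_(m \in A) Dt_sq (w n) m @[n --> \oo] --> \sum_(m \in A) Dt_sq l m.
Proof.
move=> finA wl.
have -> : (fun n => \sum_(m \in A) Dt_sq (w n) m) =
    fun n => \sum_(m <- fset_set A) Dt_sq (w n) m.
  by apply/funext => n; rewrite fsbig_finite.
rewrite fsbig_finite//=.
have sum_cvg (I : Type) (s : seq I) (F : I -> nat -> R) (f : I -> R) :
    (forall i, F i n @[n --> \oo] --> f i) ->
    \sum_(i <- s) F i n @[n --> \oo] --> \sum_(i <- s) f i.
  move=> Ff; elim: s => [|i s IH].
    by rewrite big_nil; under eq_cvg do rewrite big_nil; exact: cvg_cst.
  by rewrite big_cons; under eq_cvg do rewrite big_cons; exact: cvgD.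
apply: (sum_cvg _ _ (fun m n => Dt_sq (w n) m)) => m.
apply: (sum_cvg _ _ (fun rho n => Dt (w n) m rho ^+ 2)) => rho.
have cD : Dt (w n) m rho @[n --> \oo] --> Dt l m rho.
  rewrite /Dt; case: ifP => _; last exact: cvg_cst.
  by apply: cvgB; exact: wl.
by apply: cvgM.
Qed.

(** Point evaluations are bounded, so a pointwise limit exists. Bounds on the sums over finite sets
    of sites pass to the limit, and they give convergence in norm. *)
Lemma H1_complete : cauchy_complete (H1 R).
Proof.
move=> u cu.
have /choice[l ul] : forall m, exists l : R, u n m @[n --> \oo] --> l.
  move=> m; have [C C0 uC] := H1_eval_bounded m; apply: real_cauchy_cvg => e e0.
  have C1 : 0 < C + 1 by rewrite ltr_wpDl.
  have [N uN] := cu (e / (C + 1)) (divr_gt0 e0 C1); exists N => i j Ni Nj.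
  apply: le_trans (uC (u i - u j)) _.
  apply: (@le_trans _ _ ((C + 1) * `|u i - u j|)); first by rewrite ler_wpM2r// lerDl.
  by rewrite -ler_pdivlMl// mulrC; exact: uN.
have uAl e : 0 < e -> exists N, forall n, (N <= n)%N -> forall A : set lattice,
    finite_set A -> \sum_(m \in A) Dt_sq ((u n : lattice -> R) - l) m <= e ^+ 2.
  move=> e0; have [N uN] := cu e e0; exists N => n Nn A finA.
  have wl m : (u n - u k) m @[k --> \oo] --> ((u n : lattice -> R) - l) m.
    by apply: cvgB; [exact: cvg_cst|exact: ul].
  apply: cvgr_to_le (cvg_sum_Dt_sq finA wl) _.
  exists N; first by [].
  move=> k Nk; apply: le_trans (sum_Dt_sq_le_norm (u n - u k) finA) _.
  rewrite ler_pXn2r ?nnegrE ?H1norm_ge0 ?(ltW e0)//.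
  exact: (uN n k Nn Nk).
have l0 : l (1, 1) = 0.
  have := ul (1, 1); have -> : (fun n => u n (1, 1)) = fun _ => 0.
    by apply/funext => n; exact: H1_pin.
  by move/cvg_lim => <- //; rewrite lim_cst.
(* [l] is the difference of [u N] and [u N - l], and the bound [uAl] puts the latter in the
   space. *)
have lH : l \in @H1pred R.
  have [N uN] := uAl 1 ltr01; pose d : lattice -> R := (u N : lattice -> R) - l.
  have dH : d \in @H1pred R.
    rewrite inE; split; last by rewrite -[LHS]/(u N (1, 1) - l (1, 1)) H1_pin l0 subr0.
    apply: le_lt_trans (esum_Dt_sq_le _) (ltry (1 ^+ 2)) => A finA.
    exact: uN.
  have uH : (u N : lattice -> R) \in @H1pred R by case: (u N).
  have -> : l = (u N : lattice -> R) - d.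
    by apply/funext => m; rewrite -[RHS]/(u N m - (u N m - l m)) subKr.
  exact: rpredB.
exists (MkH1 lH) => e e0; have [N uN] := uAl e e0; exists N => n Nn.
by apply: H1norm_le => [|A finA]; [exact: ltW|exact: uN].
Qed.

Lemma prod_complete (X Y : normedModType R) :
  cauchy_complete X -> cauchy_complete Y -> cauchy_complete (X * Y)%type.
Proof.
move=> cX cY u cu.
have [|x ux] := cX (fun n => (u n).1).
  move=> e e0; have [N uN] := cu e e0; exists N => m n Nm Nn.
  by apply: le_trans (uN m n Nm Nn); rewrite prod_normE le_max lexx.
have [|y uy] := cY (fun n => (u n).2).
  move=> e e0; have [N uN] := cu e e0; exists N => m n Nm Nn.
  by apply: le_trans (uN m n Nm Nn); rewrite prod_normE le_max lexx orbT.
exists (x, y) => e e0; have [[N uN] [M uM]] := (ux e e0, uy e e0).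
exists (maxn N M) => n; rewrite geq_max => /andP[Nn Mn].
by rewrite prod_normE ge_max uN// uM.
Qed.

Lemma real_complete : cauchy_complete R.
Proof.
move=> u cu; have [l ul] := real_cauchy_cvg cu; exists l => e e0.
have /cvgrPdist_le/(_ e e0)[N _ uN] := ul; exists N => n Nn.
by rewrite distrC; exact: uN.
Qed.

End completeness.

(** * Symmetric forms and bordered operators *)

Section symmetric_forms.
Context (R : realType).
Implicit Types X Y Z : normedModType R.

(** The mean value bound for [psi], whose velocity is the difference of two remainders of [F] at [x]
    applied to [h *: w]. Differentiability of [F] at the single point [x] is therefore enough. *)
Lemma second_difference X Y (f : X -> Y) (x : X) (F : X -> Lop X Y)
    (A : Lop X (Lop X Y)) v w (e : R) :
  (\forall y \near x, fderiv f y (F y)) -> fderiv F x A -> 0 < e ->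
  exists2 d : R, 0 < d & forall h, 0 < h < d ->
    `|f (x + h *: v + h *: w) - f (x + h *: w) - (f (x + h *: v) - f x)
      - h ^+ 2 *: A v w| <= 2 * e * (`|v| + `|w|) * `|w| * h ^+ 2.
Proof.
move=> /nbhsP_norm[r r0 fF] FA e0; have [d d0 FK] := FA e e0.
pose C := `|v| + `|w| + 1.
have C0 : 0 < C by rewrite ltr_wpDl// addr_ge0.
exists (Num.min r d / C); first by rewrite divr_gt0// lt_min r0.
move=> h /andP[h0]; rewrite ltr_pdivlMr// lt_min => /andP[hr hd].
have small s : 0 <= s <= 1 -> `|h *: v + s *: (h *: w)| <= h * (`|v| + `|w|) /\
    `|s *: (h *: w)| <= h * (`|v| + `|w|).
  move=> /andP[s0 s1]; have sw : `|s *: (h *: w)| <= h * `|w|.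
    by rewrite !normrZ (ger0_norm s0) gtr0_norm// ler_piMl// mulr_ge0// ltW.
  split; last by apply: le_trans sw _; rewrite ler_wpM2l ?(ltW h0)// lerDr.
  apply: le_trans (ler_normD _ _) _; rewrite mulrDr; apply: lerD => //.
  by rewrite normrZ gtr0_norm.
have hC : h * (`|v| + `|w|) < h * C by rewrite ltr_pM2l// /C ltrDl.
pose psi s := f (x + h *: v + s *: (h *: w)) + - f (x + s *: (h *: w)) +
  - (s *: (h ^+ 2 *: A v w)).
pose psi' s := F (x + h *: v + s *: (h *: w)) (h *: w) +
  - F (x + s *: (h *: w)) (h *: w) + - (h ^+ 2 *: A v w).
have := @mean_value_unit R Y psi psi' (2 * e * (`|v| + `|w|) * `|w| * h ^+ 2).
have -> : psi 1 - psi 0 = f (x + h *: v + h *: w) - f (x + h *: w) -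
    (f (x + h *: v) - f x) - h ^+ 2 *: A v w.
  by rewrite /psi !scale1r !scale0r !addr0 subr0 addrAC.
apply=> s s01; have [s1 s2] := small s s01.
  have v1 : velocity (fun s => f (x + h *: v + s *: (h *: w))) s
      (F (x + h *: v + s *: (h *: w)) (h *: w)).
    apply: velocity_comp (velocity_line _ _ _); rewrite -addrA; apply: fF.
    exact: le_lt_trans s1 (lt_trans hC hr).
  have v2 : velocity (fun s => f (x + s *: (h *: w))) s
      (F (x + s *: (h *: w)) (h *: w)).
    apply: velocity_comp (velocity_line _ _ _); apply: fF.
    exact: le_lt_trans s2 (lt_trans hC hr).
  apply: fderivD (fderivD v1 (fderivN v2 _) _) (fderivN (velocity_scale _ _) _) _ => //.
  by move=> k; rewrite -[LHS]/(k *: psi' s) /psi' !scalerDr !scalerN.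
have := FK (h *: v + s *: (h *: w)) (le_lt_trans s1 (lt_trans hC hd)).
have := FK (s *: (h *: w)) (le_lt_trans s2 (lt_trans hC hd)).
rewrite addrA; set F0 := F x; set F1 := F (x + h *: v + _); set F2 := F (x + _).
move=> k2 k1; have -> : psi' s = (F1 - F0 - A (h *: v + s *: (h *: w))) (h *: w) -
   (F2 - F0 - A (s *: (h *: w))) (h *: w).
  rewrite LopD.
  rewrite -[X in _ = X - _]/(F1 (h *: w) - F0 (h *: w) -
    (A (h *: v) (h *: w) + A (s *: (h *: w)) (h *: w))).
  rewrite -[X in _ = _ - X]/(F2 (h *: w) - F0 (h *: w) - A (s *: (h *: w)) (h *: w)).
  have -> : A (h *: v) (h *: w) = h ^+ 2 *: A v w.
    by rewrite !LopZ -[LHS]/(h *: (h *: A v w)) scalerA.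
  rewrite /psi' !(opprD, opprK) !addrA.
  by rewrite [RHS](ACl (1*5*3*(2*6)*(4*7)))%AC/= !addNr !addr0.
apply: le_trans (ler_normB _ _) _.
have b0 : 0 <= h * `|w| by rewrite mulr_ge0// ltW.
have nhw : `|h *: w| = h * `|w| by rewrite normrZ gtr0_norm.
apply: (@le_trans _ _ (e * (h * (`|v| + `|w|)) * (h * `|w|) +
   e * (h * (`|v| + `|w|)) * (h * `|w|))); last first.
  by rewrite le_eqVlt; apply/orP; left; apply/eqP; ring.
apply: lerD; (apply: le_trans (ler_Lop _ _) _; rewrite nhw; apply: ler_wpM2r => //).
  by apply: le_trans k1 _; rewrite ler_wpM2l// ltW.
by apply: le_trans k2 _; rewrite ler_wpM2l// ltW.
Qed.

Lemma second_derivative_sym X Y (f : X -> Y) (x : X) (F : X -> Lop X Y)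
    (A : Lop X (Lop X Y)) v w :
  (\forall y \near x, fderiv f y (F y)) -> fderiv F x A -> A v w = A w v.
Proof.
move=> fF FA; apply/subr0_eq/eqP; rewrite -normr_le0; apply/ler_addgt0Pr => e e0.
(* With [e / C] as tolerance, the two errors for [(v, w)] and [(w, v)] add up to at most
   [e * h ^+ 2]; both compare the same second difference [D]. *)
pose C := 2 * (`|v| + `|w|) * (`|v| + `|w|) + 1.
have C0 : 0 < C by rewrite ltr_wpDl// !mulr_ge0 ?addr_ge0.
have e0' : 0 < e / C by rewrite divr_gt0.
have [d d0 K] := second_difference v w fF FA e0'.
have [d' d'0 K'] := second_difference w v fF FA e0'.
pose h := Num.min d d' / 2.
have m0 : 0 < Num.min d d' by rewrite lt_min d0.
have h0 : 0 < h by rewrite divr_gt0.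
have hm : h < Num.min d d' by rewrite ltr_pdivrMr// ltr_pMr// ltr1n.
have hd : 0 < h < d by rewrite h0 (lt_le_trans hm)// ge_min lexx.
have hd' : 0 < h < d' by rewrite h0 (lt_le_trans hm)// ge_min lexx orbT.
have {K} := K h hd; have {K'} := K' h hd'.
rewrite [x + h *: w + h *: v]addrAC.
set a := f _; set b := f (x + h *: w); set c := f (x + h *: v).
have -> : a - c - (b - f x) = a - b - (c - f x)
  by rewrite !(opprD, opprK) !addrA [LHS](ACl (1*3*2*4))%AC.
move: (a - b - _) => D K' K; rewrite add0r.
have h2 : 0 < h ^+ 2 by rewrite exprn_gt0.
rewrite -(ler_pM2l h2); have -> : h ^+ 2 * `|A v w - A w v| =
    `|(D - h ^+ 2 *: A w v) - (D - h ^+ 2 *: A v w)|.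
  by rewrite opprB [X in _ = `|X|]addrC subrKA -scalerBr normrZ gtr0_norm.
apply: le_trans (ler_normB _ _) _; apply: le_trans (lerD K' K) _.
rewrite -mulrDl [leRHS]mulrC ler_wpM2r ?(ltW h2)//.
have -> : 2 * (e / C) * (`|w| + `|v|) * `|v| + 2 * (e / C) * (`|v| + `|w|) * `|w| =
  e * (2 * (`|v| + `|w|) * (`|v| + `|w|) / C) by field; rewrite gt_eqF.
by rewrite ler_piMr ?(ltW e0)// ler_pdivrMr// mul1r /C lerDl.
Qed.

(* Minimises [A v v / 2 - f v] on [ker l]: minimising sequences are Cauchy by the
   parallelogram identity. *)
Lemma coercive_solve X (A : Lop X (Lop X R)) (l f : Lop X R) (c : R) :
  cauchy_complete X -> (forall v w, A v w = A w v) -> 0 < c ->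
  (forall v, l v = 0 -> c * `|v| ^+ 2 <= A v v) ->
  exists2 v, l v = 0 & forall w, l w = 0 -> A v w = f w.
Proof.
move=> cX symA c0 coer; pose J v := A v v / 2 - f v.
pose V := [set J v | v in [set v | l v = 0]].
have JD v w (t : R) : J (v + t *: w) = J v + t * (A v w - f w) + t ^+ 2 / 2 * A w w.
  rewrite /J !LopD !LopZ -[(A v + _) v]/(A v v + t * A w v).
  rewrite -[(A v + _) w]/(A v w + t * A w w) -[t *: f w]/(t * f w).
  by rewrite -[t *: (_ + _)]/(t * (_ + _)) (symA w v); field.
have Jlb : lbound V (- (`|f| ^+ 2 / (2 * c))).
  move=> _ [v lv <-]; have := coer v lv; have := ler_Lop f v.
  have := ler_norm (f v); rewrite /J.
  move: (A v v) (f v) `|f v| `|f| `|v| => a b b' m n h1 h2 h3.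
  have : 0 <= (c * n - m) ^+ 2 / (2 * c) by rewrite divr_ge0 ?sqr_ge0 ?mulr_ge0 ?ltW.
  have -> : (c * n - m) ^+ 2 / (2 * c) = c * n ^+ 2 / 2 - m * n + m ^+ 2 / (2 * c).
    by field; rewrite gt_eqF.
  lra.
have infV : has_inf V.
  by split; [exists (J 0), 0 => //; exact: Lop0|exists (- (`|f| ^+ 2 / (2 * c)))].
pose d := inf V.
have dJ v : l v = 0 -> d <= J v by move=> lv; apply: (ge_inf infV.2); exists v.
have /choice[u uP] : forall n, exists v, l v = 0 /\ J v < d + 2^-1 ^+ n.
  move=> n; have p0 : 0 < 2^-1 ^+ n :> R by rewrite exprn_gt0// invr_gt0.
  by have [_ [v lv <-] Jv] := inf_adherent p0 infV; exists v.
(* The midpoint of [u m] and [u n] lies in [ker l], so [J] is at least [d] there; [JD] with [t]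
   equal to [1] and to one half gives the identity. *)
have uu m n : c / 4 * `|u m - u n| ^+ 2 <= (J (u m) - d) + (J (u n) - d).
  have lmn : l (u m - u n) = 0 by rewrite LopB (uP m).1 (uP n).1 subr0.
  have := coer _ lmn.
  have := dJ (u n + 2^-1 *: (u m - u n)).
  rewrite LopD LopZ lmn (uP n).1 scaler0 addr0 => /(_ erefl); rewrite JD.
  have := JD (u n) (u m - u n) 1; rewrite scale1r addrC subrK => ->.
  lra.
have [|v uv] := cX u.
  move=> e e0; have e1 : 0 < c * e ^+ 2 / 8 by rewrite divr_gt0// mulr_gt0// exprn_gt0.
  have [N NK] := half_expn_small 1 e1; exists N => m n Nm Nn.
  rewrite -(@ler_pXn2r _ 2)// ?nnegrE ?(ltW e0)//.
  have := uu m n; have := NK m Nm; have := NK n Nn.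
  have := (uP m).2; have := (uP n).2; rewrite !mulr1.
  move: (J _) (J _) (_ ^+ m) (_ ^+ n) => a b a' b' h1 h2 h3 h4 h5.
  by rewrite -(ler_pM2l c0); lra.
have lv : l v = 0.
  apply/eqP; rewrite -normr_le0; apply/ler_addgt0Pr => e e0; rewrite add0r.
  have C0 : 0 < `|l| + 1 by rewrite ltr_wpDl.
  have [N NK] := uv (e / (`|l| + 1)) (divr_gt0 e0 C0).
  rewrite -normrN -[- l v]add0r -(uP N).1 -LopB; apply: le_trans (ler_Lop _ _) _.
  apply: (@le_trans _ _ ((`|l| + 1) * `|u N - v|)); first by rewrite ler_wpM2r// lerDl.
  by rewrite -ler_pdivlMl// mulrC NK.
exists v => // w lw; apply/eqP; rewrite -subr_eq0; set b := _ - _.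
have q0 : 0 <= A w w.
  by apply: le_trans (coer w lw); rewrite mulr_ge0 ?(ltW c0)// exprn_ge0.
(* The first-order condition comes from [J (u n + t *: w) >= d] in the limit of large [n]; only
   [A (u n) w] has to converge. *)
have tb (t : R) : 0 <= t * b + t ^+ 2 / 2 * A w w.
  rewrite -oppr_le0; apply/ler_addgt0Pr => e e0; rewrite add0r.
  have C0 : 0 < `|t| * (`|A| * `|w|) + 1 by rewrite ltr_wpDl// !mulr_ge0.
  have e2 : 0 < e / 2 by rewrite divr_gt0.
  have [N NK] := half_expn_small 1 e2.
  have [M MK] := uv (e / 2 / (`|t| * (`|A| * `|w|) + 1)) (divr_gt0 e2 C0).
  pose n := maxn N M.
  have ltw : l (u n + t *: w) = 0 by rewrite LopD LopZ (uP n).1 lw scaler0 addr0.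
  have := dJ _ ltw; rewrite JD; have := (uP n).2.
  have := NK n (leq_maxl _ _); rewrite mulr1.
  have err : `|t * (A (u n - v) w)| <= e / 2.
    rewrite normrM.
    apply: (@le_trans _ _ ((`|t| * (`|A| * `|w|) + 1) * `|u n - v|)); last first.
      by rewrite -ler_pdivlMl// mulrC MK// leq_maxr.
    rewrite mulrDl mul1r -[leLHS]addr0; apply: lerD => //.
    rewrite -mulrA ler_wpM2l// mulrAC; apply: le_trans (ler_Lop _ _) _.
    by rewrite ler_wpM2r// ler_Lop.
  move: (ler_norm (t * A (u n - v) w)) => err' h1 h2 h3.
  have E : t * (A (u n) w - f w) = t * b + t * A (u n - v) w.
    by rewrite LopB -[(A (u n) - A v) w]/(A (u n) w - A v w) /b; ring.
  move: h3; rewrite E; lra.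
have q1 : 0 < A w w + 1 by rewrite ltr_wpDl.
(* The minimiser of the quadratic would be [- b / A w w]; the added [1] covers the case where
   [A w w] vanishes, and the value at this [t] is still negative unless [b = 0]. *)
have := tb (- b / (A w w + 1)).
have -> : - b / (A w w + 1) * b + (- b / (A w w + 1)) ^+ 2 / 2 * A w w =
  - (b ^+ 2 * (A w w + 2) / (2 * (A w w + 1) ^+ 2)) by field; rewrite gt_eqF.
rewrite oppr_ge0 ler_pdivrMr ?mul0r; last by rewrite mulr_gt0// exprn_gt0.
by rewrite pmulr_lle0 ?ltr_wpDl// -sqrf_eq0 eq_le sqr_ge0 => ->.
Qed.

End symmetric_forms.

Section bordered_operators.
Context (R : realType).
Implicit Types X Y Z : normedModType R.

Lemma pairl_subproof X Y : (fun x : X => (x, 0 : Y)) \in @bounded_op R X (X * Y)%type.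
Proof.
rewrite inE; split.
  by move=> a u v; rewrite -[RHS]/(a *: u + v, a *: (0 : Y) + 0) scaler0 addr0.
by exists 1 => x; rewrite mul1r prod_normE/= normr0 ge_max lexx normr_ge0.
Qed.

Definition pairl X Y : Lop X (X * Y)%type := MkLop (pairl_subproof X Y).

Lemma pairr_subproof X Y : (fun y : Y => (0 : X, y)) \in @bounded_op R Y (X * Y)%type.
Proof.
rewrite inE; split.
  by move=> a u v; rewrite -[RHS]/(a *: (0 : X) + 0, a *: u + v) scaler0 addr0.
by exists 1 => x; rewrite mul1r prod_normE/= normr0 ge_max lexx normr_ge0.
Qed.

Definition pairr X Y : Lop Y (X * Y)%type := MkLop (pairr_subproof X Y).

Lemma fstl_subproof X Y (l : Lop X R) :
  (fun z : X * Y => l z.1) \in @bounded_op R (X * Y)%type R.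
Proof.
rewrite inE; split; first by move=> a u v; rewrite -LopZ -LopD.
exists `|l| => z; apply: le_trans (ler_Lop _ _) _.
by rewrite ler_wpM2l// prod_normE le_max lexx.
Qed.

Definition fstl X Y (l : Lop X R) : Lop (X * Y)%type R := MkLop (fstl_subproof Y l).

Lemma sndl_subproof X Y : (fun z : X * Y => z.2) \in @bounded_op R (X * Y)%type Y.
Proof.
rewrite inE; split; first by move=> a u v.
by exists 1 => z; rewrite mul1r prod_normE le_max lexx orbT.
Qed.

Definition sndl X Y : Lop (X * Y)%type Y := MkLop (sndl_subproof X Y).

Lemma bounded_below_isomorphism X Y (T : Lop X Y) (K : R) :
  (forall x, `|x| <= K * `|T x|) -> (forall y, exists x, T x = y) -> isomorphism T.
Proof.
move=> TK /choice[S TS].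
have inj x x' : T x = T x' -> x = x'.
  move=> Txx'; apply/subr0_eq/eqP; rewrite -normr_le0.
  by apply: le_trans (TK _) _; rewrite LopB Txx' subrr normr0 mulr0.
have Sb : S \in @bounded_op R Y X.
  rewrite inE; split; last by exists K => y; rewrite -{2}(TS y).
  by move=> a u v; apply: inj; rewrite LopD LopZ !TS.
by exists (MkLop Sb); split => [x|y] /=; [apply: inj; rewrite TS|exact: TS].
Qed.

(** The system is block triangular: [k] is read off, then [v] is [A'] of what remains. *)
Lemma bordered_regular X Y (A : Lop X Y) (b : Y) (T : Lop (X * R)%type (Y * R)%type) :
  isomorphism A -> (forall v k, T (v, k) = (A v + k *: b, k)) -> isomorphism T.
Proof.
move=> [A' [AK A'K]] TE.
apply: (@bounded_below_isomorphism _ _ _ (`|A'| * (1 + `|b|) + 1)); last first.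
  move=> [y k]; exists (A' (y - k *: b), k).
  by rewrite TE A'K subrK.
move=> [v k]; rewrite TE !prod_normE /=.
set m := Num.max `|A v + k *: b| `|k|.
have m0 : 0 <= m by rewrite le_max normr_ge0.
have km : `|k| <= m by rewrite le_max lexx orbT.
have Am : `|A v + k *: b| <= m by rewrite le_max lexx.
rewrite ge_max mulrDl mul1r; apply/andP; split; last first.
  by apply: le_trans km _; rewrite lerDr mulr_ge0// mulr_ge0// addr_ge0.
rewrite -[leLHS]addr0; apply: lerD => //.
rewrite -{1}[v]AK; apply: le_trans (ler_Lop _ _) _.
rewrite -mulrA ler_wpM2l// mulrDl mul1r -[A v](addrK (k *: b)).
apply: le_trans (ler_normB _ _) _; apply: lerD => //.
by rewrite normrZ mulrC ler_wpM2l.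
Qed.

(* [gamma] is not in [U], so the line it spans is a complement of [U], and [A]
   does not change when a multiple of [gamma] is subtracted. *)
Lemma coercive_kernel X (A : Lop X (Lop X R)) (l : Lop X R) (gamma : X)
    (U : set X) (c : R) :
  (forall v w, A v w = A w v) -> A gamma = 0 -> l gamma = 1 ->
  Defs.subspace U -> codim_le1 U -> 0 < c ->
  (forall v, U v -> c * `|v| ^+ 2 <= A v v) ->
  exists2 c' : R, 0 < c' & forall v, l v = 0 -> c' * `|v| ^+ 2 <= A v v.
Proof.
move=> symA Ag lg [U0 UD] codU c0 cU; have [e Ue] := codU.
have g0 : gamma != 0 by apply: contra_eq_neq lg => ->; rewrite Lop0 eq_sym oner_eq0.
have nUg : ~ U gamma.
  move=> /cU; rewrite Ag -[(0 : Lop X R) gamma]/(0 : R).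
  by apply/negP; rewrite -ltNge mulr_gt0// exprn_gt0// normr_gt0.
have [a Ua] := Ue gamma.
have a0 : a != 0.
  by apply/eqP => a0; apply: nUg; move: Ua; rewrite a0 scale0r subr0.
(* Modulo [U], both [v] and [gamma] are multiples of [e], and the factor [a] of [gamma] is not
   zero. *)
have split_U v : exists s, U (v - s *: gamma).
  have [s Us] := Ue v; exists (s / a).
  have := UD (- (s / a)) _ _ Ua Us; congr U.
  rewrite scalerBr scalerA mulNr divfK// !scaleNr opprK [LHS]addrC.
  by rewrite [X in _ + X = _]addrC subrKA.
(* On [ker l] the component along [gamma] is [s = - l w], so the norm of [v] is at most [M] times
   that of [w]. *)
pose M := 1 + `|l| * `|gamma|.
have M0 : 0 < M by rewrite ltr_wpDr// mulr_ge0.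
exists (c / M ^+ 2) => [|v lv]; first by rewrite divr_gt0// exprn_gt0.
have [s Us] := split_U v; set w := v - s *: gamma in Us.
have -> : A v v = A w w.
  have Awv : A w = A v by rewrite /w LopB LopZ Ag scaler0 subr0.
  by rewrite Awv symA Awv.
apply: le_trans (cU w Us).
rewrite mulrAC ler_pdivrMr ?exprn_gt0// -mulrA ler_wpM2l ?(ltW c0)// -exprMn.
rewrite ler_pXn2r ?nnegrE ?mulr_ge0 ?(ltW M0)//.
have lw : l w = - s by rewrite /w LopB lv LopZR lg mulr1 sub0r.
rewrite -[v](subrK (s *: gamma)) -/w /M mulrDr mulr1.
apply: le_trans (ler_normD _ _) _; rewrite lerD2l normrZ.
have -> : `|s| = `|l w| by rewrite lw normrN.
rewrite mulrA ler_wpM2r//; apply: le_trans (ler_Lop _ _) _.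
by rewrite mulrC.
Qed.

(** Testing the first equation against [gamma] removes [A v], by symmetry, and leaves
    [k * b gamma = f gamma]: this bounds [k]. Coercivity on [ker l] then bounds the part of [v] in
    [ker l], and [l v] bounds the rest. *)
Lemma bordered_fold X (A : Lop X (Lop X R)) (b l : Lop X R) (gamma : X)
    (c : R) (T : Lop (X * R)%type (Lop X R * R)%type) :
  cauchy_complete X -> (forall v w, A v w = A w v) -> A gamma = 0 -> l gamma = 1 ->
  b gamma != 0 -> 0 < c ->
  (forall v, l v = 0 -> c * `|v| ^+ 2 <= A v v) ->
  (forall v k, T (v, k) = (A v + k *: b, l v)) -> isomorphism T.
Proof.
move=> cX symA Ag lg bg c0 cl TE.
have proj v : l (v - l v *: gamma) = 0 by rewrite LopB LopZR lg mulr1 subrr.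
have Aproj v : A (v - l v *: gamma) = A v by rewrite LopB LopZ Ag scaler0 subr0.
pose K1 := `|gamma| / `|b gamma|.
have bg0 : 0 < `|b gamma| by rewrite normr_gt0.
have K10 : 0 <= K1 by rewrite divr_ge0.
pose K2 := (1 + K1 * `|b|) / c.
have K20 : 0 <= K2 by rewrite divr_ge0 ?(ltW c0)// addr_ge0// mulr_ge0.
apply: (@bounded_below_isomorphism _ _ _ (K1 + (K2 + `|gamma|))).
  move=> [v k]; rewrite TE !prod_normE /=.
  set f := A v + k *: b; set m := Num.max `|f| `|l v|.
  have fm : `|f| <= m by rewrite le_max lexx.
  have lm : `|l v| <= m by rewrite le_max lexx orbT.
  have m0 : 0 <= m by apply: le_trans fm.
  have kK : `|k| <= K1 * m.
    have : `|k * b gamma| <= m * `|gamma|.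
      have -> : k * b gamma = f gamma.
        by rewrite -[RHS]/(A v gamma + k * b gamma) symA Ag add0r.
      by apply: le_trans (ler_Lop _ _) _; rewrite ler_wpM2r.
    by rewrite normrM -ler_pdivlMr// -mulrA mulrC.
  have vK : `|v - l v *: gamma| <= K2 * m.
    set v0 := v - _; have := cl v0 (proj v); rewrite [A v0]Aproj.
    have [->|v00] := eqVneq v0 0; first by rewrite normr0 mulr_ge0.
    have nv0 : 0 < `|v0| by rewrite normr_gt0.
    move=> /le_trans/(_ (ler_norm _))/le_trans/(_ (ler_Lop _ _)).
    rewrite expr2 mulrA ler_pM2r// mulrC -ler_pdivlMr// => /le_trans; apply.
    rewrite /K2 mulrAC ler_wpM2r ?invr_ge0 ?(ltW c0)//.
    have -> : A v = f - k *: b by rewrite /f addrK.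
    apply: le_trans (ler_normB _ _) _; rewrite mulrDl mul1r; apply: lerD => //.
    by rewrite normrZ mulrAC ler_wpM2r.
  rewrite ge_max; apply/andP; split.
    rewrite -[v](subrK (l v *: gamma)); apply: le_trans (ler_normD _ _) _.
    rewrite mulrDl mulrDl -[leLHS]add0r; apply: lerD; first by rewrite mulr_ge0.
    by apply: lerD => //; rewrite normrZ mulrC ler_wpM2l.
  by apply: le_trans kK _; rewrite mulrDl lerDl mulr_ge0// addr_ge0.
(* This [k] makes [f - k *: b] vanish at [gamma], so that the equation solved on [ker l] holds
   against every [w]. *)
move=> [f t]; pose k := f gamma / b gamma.
have [v lv Av] := coercive_solve (f - k *: b) cX symA c0 cl.
exists (v + t *: gamma, k); rewrite TE LopD LopZ Ag scaler0 addr0.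
congr (_, _); last by rewrite LopD LopZR lv lg add0r mulr1.
apply: LopP => w; rewrite -[LHS]/(A v w + k * b w).
have := Av _ (proj w); rewrite symA Aproj symA LopB LopZR => ->.
rewrite -[(f - _) w]/(f w - k * b w) -[(f - _) gamma]/(f gamma - k * b gamma).
by rewrite /k divfK// subrr mulr0 subr0 subrK.
Qed.

End bordered_operators.

(** * Partial derivatives of the energy and the bordered equilibrium system *)

Section energy_derivatives.
Context (R : realType).
Notation H := (H1 R).
Implicit Types (E : H * R -> R) (W : set (H * R)) (z : H * R).

Lemma fderiv_partial1 (X Y Z : normedModType R) (f : X * Y -> Z) (z : X * Y)
    (L : Lop (X * Y)%type Z) :
  fderiv f z L -> fderiv (fun x => f (x, z.2)) z.1 (Lop_comp L (pairl X Y)).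
Proof.
move=> fL e e0; have [d d0 K] := fL e e0; exists d => // v vd.
have nv : `|(v, 0 : Y)| = `|v| by rewrite prod_normE/= normr0; apply/max_idPl.
have := K (v, 0); rewrite nv => /(_ vd).
have -> : z + (v, 0) = (z.1 + v, z.2).
  by case: z {fL K} => x y; rewrite -[LHS]/(x + v, y + 0) addr0.
by case: z {fL K}.
Qed.

Lemma fderiv_partial2 (X Y Z : normedModType R) (f : X * Y -> Z) (z : X * Y)
    (L : Lop (X * Y)%type Z) :
  fderiv f z L -> fderiv (fun y => f (z.1, y)) z.2 (Lop_comp L (pairr X Y)).
Proof.
move=> fL e e0; have [d d0 K] := fL e e0; exists d => // v vd.
have nv : `|(0 : X, v)| = `|v| by rewrite prod_normE/= normr0; apply/max_idPr.
have := K (0, v); rewrite nv => /(_ vd).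
have -> : z + (0, v) = (z.1, z.2 + v).
  by case: z {fL K} => x y; rewrite -[LHS]/(x + 0, y + v) addr0.
by case: z {fL K}.
Qed.

Lemma d_uE n E W z : class_C n.+1 W E -> W z ->
  d_u E z = Lop_comp (dop E z) (pairl H R).
Proof. by move=> cE Wz; have /fderiv_partial1/fderivP[] := class_C_fderiv cE Wz. Qed.

Lemma class_C_d_u n E W : open W -> class_C n.+1 W E -> class_C n W (d_u E).
Proof.
move=> oW cE.
apply: (@class_C_eq _ _ _ _ _ (fun z => Lop_pre R (pairl H R) (dop E z))) => //.
  by move=> z Wz; rewrite (d_uE cE Wz).
by apply: class_C_post => //; case: cE.
Qed.

Lemma dop_d_uE n E W z v k : open W -> class_C n.+2 W E -> W z ->
  dop (d_u E) z (v, k) = d_uu E z v + k *: d_uk E z 1.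
Proof.
move=> oW cE Wz; have cF := class_C_d_u oW cE.
have FL := class_C_fderiv cF Wz.
have /fderivP[_ duu] := fderiv_partial1 FL; have /fderivP[_ duk] := fderiv_partial2 FL.
rewrite /d_uu duu /d_uk duk.
have -> : Lop_comp (dop (d_u E) z) (pairl H R) v = dop (d_u E) z (v, 0) by [].
have -> : Lop_comp (dop (d_u E) z) (pairr H R) (1 : R) = dop (d_u E) z (0, 1) by [].
rewrite -LopZ -LopD; congr (opfun (dop _ _) _).
by rewrite -[RHS]/(v + k *: (0 : H), 0 + k * 1) scaler0 addr0 add0r mulr1.
Qed.

Lemma d_uu_sym n E W z v w : open W -> class_C n.+2 W E -> W z ->
  d_uu E z v w = d_uu E z w v.
Proof.
move=> oW cE Wz; have cF := class_C_d_u oW cE.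
apply: (@second_derivative_sym _ _ _ (fun u => E (u, z.2)) z.1 (fun u => d_u E (u, z.2))).
  have [r r0 Wr] := open_normP oW Wz; apply/nbhsP_norm; exists r => // u ur.
  have Wu : W (z.1 + u, z.2).
    have -> : (z.1 + u, z.2) = z + (u, 0).
      by case: z {Wz Wr} => x y; rewrite -[RHS]/(x + u, y + 0) addr0.
    by apply: Wr; rewrite prod_normE/= normr0; move/max_idPl: (normr_ge0 u) => ->.
  by rewrite (d_uE cE Wu); exact: (fderiv_partial1 (class_C_fderiv cE Wu)).
have /fderiv_partial1 FL := class_C_fderiv cF Wz.
by have /fderivP[_ duu] := FL; rewrite /d_uu duu.
Qed.

(** Evaluation at a site where [gamma] does not vanish, normalised there. *)
Lemma H1_functional (gamma : H) : gamma != 0 -> exists l : Lop H R, l gamma = 1.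
Proof.
move=> g0.
have [m gm] : exists m, gamma m != 0.
  apply: contrapT => nex; move/eqP: g0; apply; apply/val_inj/funext => m.
  by apply: contrapT => /eqP gm; apply: nex; exists m.
have [C C0 vC] := H1_eval_bounded R m.
have [||l lE] := @Lop_exists R _ _ (fun v : H => v m / gamma m) (C / `|gamma m|).
  - by move=> a u v; rewrite -[X in X / _]/(a * u m + v m) mulrDl -mulrA.
  - by move=> v; rewrite normrM normfV mulrAC ler_wpM2r ?invr_ge0.
by exists l; rewrite lE divff.
Qed.

(** The pair [(d_u E, l)] is written as a sum of bounded operators applied to its components, so
    that the rules for sums and compositions give its class and its derivative. *)
Lemma bordered_isomorphism n E W z (c : R) (U : set H) :
  open W -> class_C n.+2 W E -> W z -> regular_point E z \/ fold_point E z ->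
  Defs.subspace U -> codim_le1 U -> 0 < c ->
  (forall v, U v -> c * `|v| ^+ 2 <= d_uu E z v v) ->
  exists l : Lop (H * R)%type R,
    isomorphism (dop (fun y => pairl _ _ (d_u E y) + pairr _ _ (l y)) z
      : Lop (H * R)%type (Lop H R * R)%type).
Proof.
move=> oW cE Wz reg_fold subU codU c0 cU; have cF := class_C_d_u oW cE.
have dopG (l : Lop (H * R)%type R) v k :
    dop (fun y => pairl _ _ (d_u E y) + pairr _ _ (l y)) z (v, k) =
    (d_uu E z v + k *: d_uk E z 1, l (v, k)) :> Lop H R * R.
  have := fderivD (fderiv_post (pairl (Lop H R) R) (class_C_fderiv cF Wz))
    (fderiv_post (pairr (Lop H R) R) (fderiv_Lop l z)).
  move=> /(_ (Lop_comp (pairl _ _) (dop (d_u E) z) + Lop_comp (pairr _ _) l)).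
  move=> /(_ (fun=> erefl))/fderivP[_ ->].
  rewrite -(dop_d_uE v k oW cE Wz).
  by rewrite -[LHS]/(dop (d_u E) z (v, k) + 0, 0 + l (v, k)) addr0 add0r.
case: reg_fold => [[_ isoA]|[_ [gamma [g0 kerA bg _]]]].
  by exists (sndl H R); apply: (bordered_regular isoA) => v k; rewrite dopG.
have [l lg] := H1_functional g0.
have Ag : d_uu E z gamma = 0 by apply/kerA; exists 1; rewrite scale1r.
have symA v w := d_uu_sym v w oW cE Wz.
have [c' c'0 cl] := coercive_kernel symA Ag lg subU codU c0 cU.
exists (fstl R l).
apply: (bordered_fold (@H1_complete R) symA Ag lg bg c'0 cl) => v k.
by rewrite dopG.
Qed.

End energy_derivatives.

(** * Injective paths of solutions *)

Section paths.
Context (R : realType).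
Implicit Types X Y : normedModType R.

Lemma withinP_norm X Y (A : set X) (f : X -> Y) :
  {within A, continuous f} <-> forall x, A x -> forall e : R, 0 < e ->
    exists2 d : R, 0 < d & forall y, A y -> `|y - x| < d -> `|f y - f x| <= e.
Proof.
rewrite subspace_continuousP; split.
  move=> cf x Ax e e0; have /cvgrPdist_le/(_ e e0)/nbhsP_norm[d d0 K] := cf x Ax.
  exists d => // y Ay yx; rewrite distrC.
  by have := K (y - x) yx; rewrite addrC subrK; exact.
move=> cf x Ax; apply/cvgrPdist_le => e e0; have [d d0 K] := cf x Ax e e0.
apply/nbhsP_norm; exists d => // v vd Axv; rewrite distrC; apply: K => //.
by rewrite addrC addKr.
Qed.

Lemma lipschitz_open_lt X (f : X -> R) (K c : R) :
  (forall x v, `|f (x + v) - f x| <= K * `|v|) -> open [set x | f x < c].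
Proof.
move=> fK; apply: (@open_comp _ _ f [set y | y < c]); last exact: open_lt.
move=> x _; apply/continuousP_norm => e e0; have K0 : 0 < `|K| + 1 by rewrite ltr_wpDl.
exists (e / (`|K| + 1)) => [|v ve]; first by rewrite divr_gt0.
apply: le_trans (fK x v) _; apply: (@le_trans _ _ ((`|K| + 1) * `|v|)).
  by rewrite ler_wpM2r// (le_trans (ler_norm K))// lerDl.
by rewrite -ler_pdivlMl// mulrC ltW.
Qed.

(** A negative value at some [x] would force a zero between [x] and [eta], by the intermediate value
    theorem; the same theorem gives all values up to [f eta]. *)
Lemma half_line_pos (f : R -> R) (eta : R) : 0 < eta ->
  {within `[0, eta], continuous f} -> f 0 = 0 ->
  (forall x, 0 < x <= eta -> f x != 0) -> 0 < f eta ->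
  (forall x, 0 <= x <= eta -> 0 <= f x) /\
  forall t, 0 <= t <= f eta -> exists2 x, 0 <= x <= eta & f x = t.
Proof.
move=> eta0 cf f0 fn0 fe; split=> [x /andP[x0 xe]|t /andP[t0 te]].
  rewrite leNgt; apply/negP => fx.
  have cfx : {within `[x, eta], continuous f}.
    apply: continuous_subspaceW cf => y /=; rewrite !in_itv/= => /andP[xy ->].
    by rewrite andbT (le_trans x0).
  have [|y] := @IVT _ f x eta 0 xe cfx; last rewrite in_itv/= => /andP[xy ye] fy.
    by rewrite ge_min le_max (ltW fx) (ltW fe) orbT.
  have xn0 : x != 0 by apply/eqP => x00; move: fx; rewrite x00 f0 ltxx.
  have : f y != 0 by apply: fn0; rewrite ye andbT (lt_le_trans _ xy)// lt_def xn0.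
  by rewrite fy eqxx.
have [|y] := @IVT _ f 0 eta t (ltW eta0) cf; last by rewrite in_itv; exists y.
by rewrite f0 ge_min le_max t0 te orbT.
Qed.

Lemma half_line_sign (f : R -> R) (eta : R) : 0 < eta ->
  {within `[0, eta], continuous f} -> f 0 = 0 ->
  (forall x, 0 < x <= eta -> f x != 0) ->
  exists sg eps : R, [/\ sg = 1 \/ sg = -1, 0 < eps,
    forall x, 0 <= x <= eta -> 0 <= sg * f x &
    forall t, 0 <= t < eps -> exists2 x, 0 <= x <= eta & f x = sg * t].
Proof.
move=> eta0 cf f0 fn0.
have fe : f eta != 0 by apply: fn0; rewrite eta0 lexx.
have [fp|fn|fz] := ltgtP 0 (f eta); last by rewrite -fz eqxx in fe.
  have [pos reach] := half_line_pos eta0 cf f0 fn0 fp.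
  exists 1, (f eta); split=> [||x|t]; [by left|by []|by rewrite mul1r; exact: pos|].
  by move=> /andP[t0 te]; rewrite mul1r; apply: reach; rewrite t0 ltW.
have cNf : {within `[0, eta], continuous (fun x => - f x)}.
  by move=> x; apply: continuousN; exact: cf.
have [|||pos reach] := @half_line_pos (fun x => - f x) eta eta0 cNf.
- by rewrite f0 oppr0.
- by move=> x xe; rewrite oppr_eq0 fn0.
- by rewrite oppr_gt0.
exists (-1), (- f eta); split=> [||x|t];
  [by right|by rewrite oppr_gt0|by rewrite mulN1r; exact: pos|].
move=> /andP[t0 te]; have [|x xe fx] := reach t; first by rewrite t0 ltW.
by exists x => //; rewrite mulN1r -fx opprK.
Qed.

(** The parameters at distance at least [d] from [s0] form a compact set; its image is closed and,
    by injectivity, misses [B s0]. *)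
Lemma injective_path_inverse X (B : R -> X) (s0 d : R) :
  {within `[0, 1], continuous B} -> {in `[0, 1]%R &, injective B} ->
  s0 \in `[0, 1]%R -> 0 < d ->
  exists2 r : R, 0 < r & forall s, s \in `[0, 1]%R -> `|B s - B s0| < r -> `|s - s0| < d.
Proof.
move=> cB iB s01 d0; pose K : set R := `[0, 1]%classic `&` [set s | d <= `|s - s0|].
have KI : K `<=` `[0, 1] by move=> s [].
have cK : compact K.
  apply: compact_closedI; first exact: segment_compact.
  apply: (@closed_comp _ _ (fun s : R => `|s - s0|) [set x | d <= x]); last exact: closed_ge.
  move=> s _; apply/continuousP_norm => e e0; exists e => // v ve.
  apply: le_trans (ler_dist_dist _ _) _.
  by rewrite opprB addrA subrK addrAC subrr add0r ltW.
have cBK : closed (B @` K).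
  apply: compact_closed; first exact: norm_hausdorff.
  by apply: continuous_compact cK; exact: continuous_subspaceW cB.
have nB : (~` (B @` K)) (B s0).
  move=> [s [sI sd] /iB sE]; move: sd.
  by rewrite /= sE// subrr normr0 leNgt d0.
have [r r0 rK] := open_normP (closed_openC cBK) nB.
exists r => // s sI sr; rewrite ltNge; apply/negP => ds.
by have := rK _ sr; rewrite addrC subrK; apply; exists s.
Qed.

Lemma curve_C_sub X n (J J' : set R) (f : R -> X) :
  J' `<=` J -> curve_C n J f -> curve_C n J' f.
Proof.
move=> JJ; elim: n f => [|n IH] f; first by move=> cf t /JJ; exact: cf.
by move=> [f' [hf cf]]; exists f'; split; [move=> t /JJ; exact: hf|exact: IH].
Qed.

Lemma velocity_derive1 X (f : R -> X) t v : velocity f t v -> derive1 f t = v.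
Proof.
by move=> /fderivP[df fL]; rewrite derive1E'// -dopE// fL -[LHS]/(1 *: v) scale1r.
Qed.

(* [Q] is the half-line [t >= 0] at an end point of the path and everything at
   an interior point. *)
Lemma local_chart X Y n (W : set X) (F : X -> Y) (l : Lop X R) (M : set X)
    (p : X) (sg : R) (Q : set R) (r1 r2 eps1 : R) :
  cauchy_complete X -> open W -> W p -> class_C n.+1 W F ->
  isomorphism (dop (fun z => pairl Y R (F z) + pairr Y R (l z)) p) ->
  sg = 1 \/ sg = -1 -> 0 < r1 -> 0 < r2 -> 0 < eps1 -> M p ->
  (forall z, M z -> F z = F p) ->
  (forall z z', `|z - p| < r1 -> `|z' - p| < r1 -> F z = F z' -> l z = l z' -> z = z') ->
  (forall t, Q t -> `|t| < eps1 ->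
     exists z, [/\ M z, `|z - p| < r1 & l z = l p + sg * t]) ->
  (forall z, M z -> `|z - p| < r2 -> Q (sg * (l z - l p))) ->
  exists (O : set X) (eps : R) (g : R -> X) (h : X -> R),
    let J := [set t : R | Q t /\ `|t| < eps] in
    [/\ open O, O p, 0 < eps & g 0 = p] /\
    [/\ class_C n.+1 (`]- eps, eps[%classic : set R) g,
        forall t, `]- eps, eps[%classic t -> derive1 g t != 0,
        g @` J = M `&` O,
        {within M `&` O, continuous h} &
        forall t, J t -> h (g t) = t].
Proof.
move=> cX oW Wp cF isoG sg1 r10 r20 eps10 Mp FM inj reach sign.
have sgK t : sg * (sg * t) = t by case: sg1 => ->; ring.
have nsg t : `|sg * t| = `|t| by case: sg1 => ->; rewrite ?mul1r ?mulN1r ?normrN.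
(* Along the direction [(0, sg)] the curve keeps [F] constant and moves [l] with speed [sg]. *)
have e0 : (0 : Y, sg) != 0.
  by apply/eqP => -[sg0]; case: sg1; rewrite sg0; [move/eqP; rewrite eq_sym oner_eq0|
     move/eqP; rewrite eq_sym oppr_eq0 oner_eq0].
have cG : class_C n.+1 W (fun z => pairl Y R (F z) + pairr Y R (l z)).
  by apply: class_CD => //; apply: class_C_post => //; exact: class_C_Lop.
have [r [eps [g [[r0 eps0 g0] [cg vg gP injG]]]]] := inverse_curve cX oW Wp cG isoG e0.
pose J0 := `]- eps, eps[%classic : set R.
have J0P t : `|t| < eps -> J0 t by rewrite ltr_norml /J0 /= in_itv.
have gF t : `|t| < eps -> F (g t) = F p /\ l (g t) = l p + sg * t.
  move=> /J0P /gP[_ _ Gt]; split.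
    by have := congr1 fst Gt; rewrite /= !addr0 scaler0 addr0.
  by have := congr1 snd Gt; rewrite /= !add0r mulrC.
pose rho := Num.min (Num.min r1 r2) r.
have rho0 : 0 < rho by rewrite !lt_min r10 r20.
have [d d0 gd] : exists2 d : R, 0 < d & forall t, `|t| < d -> `|g t - p| < rho.
  have J00 : J0 0 by apply: J0P; rewrite normr0.
  have [v /velocity_continuous/continuousP_norm cg0 _] := vg 0 J00.
  have [d d0 K] := cg0 _ (divr_gt0 rho0 (ltr0n _ 2)).
  exists d => // t /K; rewrite add0r g0 => /le_lt_trans; apply.
  by rewrite ltr_pdivrMr// ltr_pMr// ltr1n.
pose ep := Num.min (Num.min eps1 eps) d.
have ep0 : 0 < ep by rewrite !lt_min eps10 eps0.
have epP t : `|t| < ep -> [/\ `|t| < eps1, `|t| < eps & `|g t - p| < rho].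
  move=> tep; have : (`|t| < eps1) && (`|t| < eps) && (`|t| < d) by rewrite -!lt_min.
  by move=> /andP[/andP[t1 t2] t3]; split=> //; exact: gd.
have rhoP z : `|z - p| < rho -> `|z - p| < r1 /\ `|z - p| < r2.
  by rewrite !lt_min => /andP[/andP[zr1 zr2] _].
(* The second condition puts the parameter of every point of [O] in the range of the chart. The
   inverse chart is an affine function of [l], hence continuous everywhere. *)
exists [set z | `|z - p| < rho /\ `|l z - l p| < ep], ep, g,
  (fun z => sg * (l z - l p)) => J.
have hg t : `|t| < eps -> sg * (l (g t) - l p) = t.
  by move=> /gF[_ ->]; rewrite addrC addKr sgK.
split; split => //.
- apply: openI; [apply: (@lipschitz_open_lt _ _ 1)|apply: (@lipschitz_open_lt _ _ `|l|)].
    move=> z v; apply: le_trans (ler_dist_dist _ _) _.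
    by rewrite mul1r opprB addrA subrK addrAC subrr add0r.
  move=> z v; apply: le_trans (ler_dist_dist _ _) _.
  rewrite opprB addrA subrK -LopB addrAC subrr add0r.
  exact: ler_Lop.
- by rewrite /= !subrr !normr0.
- apply: curve_C_class_C; first exact: interval_open.
  apply: curve_C_sub cg => t; rewrite /= !in_itv/= -!ltr_norml.
  by move=> /epP[].
- move=> t; rewrite /= in_itv/= -ltr_norml => /epP[_ /J0P/vg[v gv v0] _].
  by rewrite (velocity_derive1 gv).
- apply/seteqP; split => [_ [t [Qt tep] <-]|z [Mz [zrho zl]]].
    have [t1 t2 gr] := epP t tep; have [z [Mz zr lz]] := reach t Qt t1.
    have [Fg lg] := gF t t2.
    have gz : g t = z by apply: inj; rewrite ?Fg ?FM ?lg ?lz//; have [] := rhoP _ gr.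
    rewrite gz in gr *; split=> //; split=> //=.
    by rewrite lz [l p + _]addrC addrK nsg.
  have [zr1 zr2] := rhoP z zrho.
  exists (sg * (l z - l p)); first by split; [exact: sign|rewrite nsg].
  have tep : `|sg * (l z - l p)| < ep by rewrite nsg.
  have [t1 t2 gr] := epP _ tep; have [Fg lg] := gF _ t2.
  apply: inj => //; [by have [] := rhoP _ gr|by rewrite Fg FM|].
  by rewrite lg sgK addrC subrK.
- apply: continuous_subspaceT => z; apply: cvgM; first exact: cvg_cst.
  by apply: cvgB; [exact: Lop_continuous|exact: cvg_cst].
- by move=> t [Qt /epP[_ teps _]]; exact: hg.
Qed.

End paths.

(** * From local charts to the whole path *)

Section path_submanifold.
Context (R : realType).
Implicit Types X Y : normedModType R.

(** By local injectivity of [l] along the path, [l (B s) - l (B s0)] vanishes only at [s0], so it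
    keeps one sign on the half path and covers a half-interval of values. *)
Lemma half_path X (B : R -> X) (l : Lop X R) (s0 d eta r : R) :
  {within `[0, 1], continuous B} -> d = 1 \/ d = -1 -> 0 < eta ->
  (forall x, 0 <= x <= eta -> s0 + d * x \in `[0, 1]%R) ->
  (forall x, 0 <= x <= eta -> `|B (s0 + d * x) - B s0| < r) ->
  (forall s s', s \in `[0, 1]%R -> s' \in `[0, 1]%R -> `|B s - B s0| < r ->
     `|B s' - B s0| < r -> l (B s) = l (B s') -> s = s') ->
  exists sg eps : R, [/\ sg = 1 \/ sg = -1, 0 < eps,
    forall x, 0 <= x <= eta -> 0 <= sg * (l (B (s0 + d * x)) - l (B s0)) &
    forall t, 0 <= t < eps ->
      exists2 x, 0 <= x <= eta & l (B (s0 + d * x)) = l (B s0) + sg * t].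
Proof.
move=> cB d1 eta0 s0I s0r inj.
have nd x : `|d * x| = `|x| by case: d1 => ->; rewrite ?mul1r ?mulN1r ?normrN.
have e0 : (0 : R) <= 0 <= eta by rewrite lexx ltW.
have [|||sg [eps [sg1 eps0 sgP reach]]] :=
  @half_line_sign R (fun x => l (B (s0 + d * x)) - l (B s0)) eta eta0.
- apply/withinP_norm => x; rewrite /= in_itv/= => xe e ep0.
  have C0 : 0 < `|l| + 1 by rewrite ltr_wpDl.
  have [d' d'0 K] := (withinP_norm _ _).1 cB _ (s0I x xe) _ (divr_gt0 ep0 C0).
  exists d' => // y; rewrite /= in_itv/= => ye yx.
  rewrite opprB addrA subrK -LopB; apply: le_trans (ler_Lop _ _) _.
  apply: (@le_trans _ _ ((`|l| + 1) * `|B (s0 + d * y) - B (s0 + d * x)|)).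
    by rewrite ler_wpM2r// lerDl.
  rewrite -ler_pdivlMl// [leRHS]mulrC; apply: K; first exact: s0I.
  by rewrite opprD addrACA subrr add0r -mulrBr nd.
- by rewrite mulr0 addr0 subrr.
- move=> x /andP[x0 xe]; rewrite subr_eq0; apply/eqP => lx.
  have xe' : 0 <= x <= eta by rewrite ltW.
  have s00 : s0 = s0 + d * 0 by rewrite mulr0 addr0.
  have := inj _ _ (s0I x xe') (s0I 0 e0) (s0r x xe') (s0r 0 e0).
  rewrite -s00 => /(_ lx)/eqP; rewrite -subr_eq0 addrC addKr -normr_eq0 nd normr_eq0.
  by rewrite gt_eqF.
exists sg, eps; split=> // t /reach[x xe lx]; exists x => //.
by rewrite -lx [RHS]addrC subrK.
Qed.

Theorem path_submanifold X Y n (W : set X) (F : X -> Y) (B : R -> X) :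
  cauchy_complete X -> open W -> class_C n.+1 W F -> B @` `[0, 1] `<=` W ->
  {within `[0, 1], continuous B} -> {in `[0, 1]%R &, injective B} ->
  (forall s s', s \in `[0, 1]%R -> s' \in `[0, 1]%R -> F (B s) = F (B s')) ->
  (forall s, s \in `[0, 1]%R -> exists l : Lop X R,
     isomorphism (dop (fun z => pairl Y R (F z) + pairr Y R (l z)) (B s))) ->
  submanifold1 n.+1 (B @` `[0, 1]) [set B 0; B 1].
Proof.
move=> cX oW cF BW cB iB FB isoB.
have I0 : (0 : R) \in `[0, 1]%R by rewrite in_itv/= lexx ler01.
have I1 : (1 : R) \in `[0, 1]%R by rewrite in_itv/= lexx ler01.
split; first by move=> _ [->|->]; [exists 0|exists 1].
move=> _ [s0 s0I <-]; have [l isoG] := isoB s0 s0I.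
set p := B s0 in isoG *; set M := B @` `[0, 1].
have Mp : M p by exists s0.
have Wp : W p by exact: BW.
have FM z : M z -> F z = F p by move=> [s sI <-]; exact: FB.
(* Only the local injectivity of [(F, l)] is taken from [inverse_curve] here, so the direction
   [(0, 1)] is an arbitrary nonzero choice. *)
have [r1 r10 inj] : exists2 r1 : R, 0 < r1 & forall z z', `|z - p| < r1 ->
    `|z' - p| < r1 -> F z = F z' -> l z = l z' -> z = z'.
  have cG : class_C n.+1 W (fun z => pairl Y R (F z) + pairr Y R (l z)).
    by apply: class_CD => //; apply: class_C_post => //; exact: class_C_Lop.
  have e0 : (0 : Y, 1 : R) != 0 by apply/eqP => -[] /eqP; rewrite oner_eq0.
  have [r [eps [g [[r0 eps0 g0] [_ _ _ injG]]]]] := inverse_curve cX oW Wp cG isoG e0.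
  by exists r => // z z' zr z'r Fz lz; apply: injG => //; rewrite Fz lz.
have injs s s' : s \in `[0, 1]%R -> s' \in `[0, 1]%R -> `|B s - B s0| < r1 ->
     `|B s' - B s0| < r1 -> l (B s) = l (B s') -> s = s'.
  by move=> sI s'I sr s'r ls; apply: iB => //; apply: inj => //; exact: FB.
have [d d0 Bd] : exists2 d : R, 0 < d & forall s, s \in `[0, 1]%R -> `|s - s0| < d ->
    `|B s - p| < r1.
  have r20 : 0 < r1 / 2 by rewrite divr_gt0.
  have [d d0 K] := (withinP_norm _ _).1 cB s0 s0I _ r20; exists d => // s sI sd.
  by apply: le_lt_trans (K s sI sd) _; rewrite ltr_pdivrMr// ltr_pMr// ltr1n.
have half dir eta : dir = 1 \/ dir = -1 -> 0 < eta < d ->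
    (forall x, 0 <= x <= eta -> s0 + dir * x \in `[0, 1]%R) ->
  exists sg eps : R, [/\ sg = 1 \/ sg = -1, 0 < eps,
    forall x, 0 <= x <= eta -> 0 <= sg * (l (B (s0 + dir * x)) - l p) &
    forall t, 0 <= t < eps -> exists2 x, 0 <= x <= eta &
      [/\ M (B (s0 + dir * x)), `|B (s0 + dir * x) - p| < r1 &
          l (B (s0 + dir * x)) = l p + sg * t]].
  move=> dir1 /andP[eta0 etad] dirI.
  have dirr x : 0 <= x <= eta -> `|B (s0 + dir * x) - p| < r1.
    move=> /[dup] xe /andP[x0 xeta]; apply: Bd; first exact: dirI.
    rewrite addrC addKr; apply: le_lt_trans etad; apply: le_trans xeta.
    by case: dir1 => ->; rewrite ?mul1r ?mulN1r ?normrN ger0_norm.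
  have [sg [eps [sg1 eps0 sgP reach]]] := half_path cB dir1 eta0 dirI dirr injs.
  exists sg, eps; split=> // t /reach[x xe lx]; exists x => //.
  by split=> //; [exists (s0 + dir * x) => //; exact: dirI|exact: dirr].
have [pbd|pnbd] := boolP (p \in [set B 0; B 1]).
  (* [dir] points from the end point into the parameter interval, and every parameter is then
     determined by its distance to [s0]. *)
  have [dir [dir1 dirI dirN]] : exists dir : R, [/\ dir = 1 \/ dir = -1,
      forall x, 0 <= x <= 1 -> s0 + dir * x \in `[0, 1]%R &
      forall s, s \in `[0, 1]%R -> s = s0 + dir * `|s - s0|].
    move: pbd; rewrite inE => -[/iB|/iB] -> //.
      exists 1; split=> [|x|s]; [by left|by rewrite in_itv/= add0r mul1r|].
      by rewrite in_itv/= => /andP[s0' _]; rewrite subr0 add0r mul1r ger0_norm.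
    exists (-1); split=> [|x|s]; first by right.
      by rewrite in_itv/= mulN1r subr_ge0 gerBl andbC.
    rewrite in_itv/= => /andP[_ s1]; rewrite distrC ger0_norm ?subr_ge0//.
    by rewrite mulN1r subKr.
  pose eta := Num.min (d / 2) 1.
  have eta0 : 0 < eta < d.
    rewrite lt_min ltr01 divr_gt0//= gt_min ltr_pdivrMr// ltr_pMr//.
    by rewrite ltr1n.
  have eta1 : eta <= 1 by rewrite ge_min lexx orbT.
  have etaI x : 0 <= x <= eta -> s0 + dir * x \in `[0, 1]%R.
    by move=> /andP[x0 xe]; apply: dirI; rewrite x0 (le_trans xe).
  have [sg [eps1 [sg1 eps10 sgP reach]]] := half dir eta dir1 eta0 etaI.
  (* Points of the path near [p] have parameters near [s0], where the sign of [l z - l p] is known;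
     this gives the condition on [Q]. *)
  have [r2 r20 Br2] := injective_path_inverse cB iB s0I (andP eta0).1.
  have [||O [eps [g [h [c1 [gC dg gJ hc hg]]]]]] :=
    @local_chart R X Y n W F l M p sg [set t | 0 <= t] r1 r2 eps1 cX oW Wp cF isoG sg1 r10 r20 eps10 Mp FM inj.
  - move=> t t0 teps; have [|x xe Bx] := reach t; last by exists (B (s0 + dir * x)).
    by rewrite t0/= -(ger0_norm t0).
  - move=> _ [s sI <-] sr; rewrite /= (dirN s sI); apply: sgP.
    by rewrite normr_ge0 ltW// Br2.
  exists O, eps, g, h.
  suff -> : `[0, eps[%classic = [set t : R | 0 <= t /\ `|t| < eps] by [].
  apply/seteqP; split=> t; rewrite /= in_itv/=.
    by move=> /andP[t0 te]; rewrite ger0_norm.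
  by move=> [t0]; rewrite ger0_norm// t0.
have s0n0 : s0 != 0.
  by apply: contraNneq pnbd => s00; rewrite /p s00 inE; left.
have s0n1 : s0 != 1.
  by apply: contraNneq pnbd => s00; rewrite /p s00 inE; right.
have [s0p s01] : 0 < s0 /\ s0 < 1.
  move: s0I; rewrite /= in_itv/= => /andP[s00 s01].
  by split; rewrite lt_neqAle ?s00 ?s01 andbT// eq_sym.
pose eta := Num.min (d / 2) (Num.min s0 (1 - s0)).
have eta0 : 0 < eta < d.
  rewrite !lt_min s0p subr_gt0 s01 divr_gt0//= gt_min ltr_pdivrMr// ltr_pMr//.
  by rewrite ltr1n.
have [eta1 eta2] : eta <= s0 /\ eta <= 1 - s0.
  by rewrite !ge_min !lexx !orbT.
have etaIp x : 0 <= x <= eta -> s0 + 1 * x \in `[0, 1]%R.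
  by move=> /andP[x0 xe]; rewrite in_itv/=; apply/andP; split; lra.
have etaIn x : 0 <= x <= eta -> s0 + -1 * x \in `[0, 1]%R.
  by move=> /andP[x0 xe]; rewrite in_itv/=; apply/andP; split; lra.
have [sp [ep [sp1 ep0 _ reachp]]] := half 1 eta (or_introl erefl) eta0 etaIp.
have [sn [en [sn1 en0 _ reachn]]] := half (-1) eta (or_intror erefl) eta0 etaIn.
have spn : sn = - sp.
  (* If the signs agreed, both halves would reach one common level [t > 0]; local injectivity would
     give [s0 + x = s0 - y], hence [x = 0] and [t = 0]. *)
  have neq : sp != sn.
    apply/eqP => spn; pose t := Num.min ep en / 2.
    have t0 : 0 < t by rewrite divr_gt0// lt_min ep0.
    have tm : t < Num.min ep en by rewrite ltr_pdivrMr// ltr_pMr ?ltr1n// lt_min ep0.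
    move: tm; rewrite lt_min => /andP[tp tn].
    have [|x xe [_ Bx lx]] := reachp t; first by rewrite ltW.
    have [|y ye [_ By ly]] := reachn t; first by rewrite ltW.
    have := injs _ _ (etaIp x xe) (etaIn y ye) Bx By; rewrite lx ly spn => /(_ erefl).
    have [x0 y0] : 0 <= x /\ 0 <= y by case/andP: xe; case/andP: ye.
    move=> xy; have x00 : x = 0 by lra.
    move: lx; rewrite x00 mulr0 addr0 -/p => lx.
    have : sp * t = 0 by apply: (addrI (l p)); rewrite -lx addr0.
    apply/eqP/mulf_neq0; last by rewrite gt_eqF.
    by case: sp1 => ->; rewrite ?oppr_eq0 oner_eq0.
  by case: sp1 sn1 neq => -> [] ->; rewrite ?eqxx// opprK.
pose eps1 := Num.min ep en.
have eps10 : 0 < eps1 by rewrite lt_min ep0.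
have [||O [eps [g [h [c1 [gC dg gJ hc hg]]]]]] :=
    @local_chart R X Y n W F l M p 1 setT r1 1 eps1 cX oW Wp cF isoG (or_introl erefl) r10 ltr01 eps10 Mp FM inj.
- move=> t _; rewrite lt_min => /andP[tp tn].
  have st : `|sp * t| = `|t| by case: sp1 => ->; rewrite ?mul1r ?mulN1r ?normrN.
  have spt : sp * (sp * t) = t by case: sp1 => ->; ring.
  (* The sign of [sp * t] decides which half of the path attains the level [l p + t]. *)
  have [t0|t0] := leP 0 (sp * t).
    have [|x xe [Bx1 Bx2 Bx3]] := reachp (sp * t); last first.
      by exists (B (s0 + 1 * x)); split=> //; rewrite Bx3 spt mul1r.
    by rewrite t0 -(ger0_norm t0) st.
  have t0' : 0 <= sn * t by rewrite spn mulNr oppr_ge0 ltW.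
  have [|x xe [Bx1 Bx2 Bx3]] := reachn (sn * t); last first.
    exists (B (s0 + -1 * x)); split=> //.
    by rewrite Bx3 spn !mulNr mulrN opprK spt mul1r.
  by rewrite t0' -(ger0_norm t0') spn mulNr normrN st.
- by [].
have EJ : [set t : R | setT t /\ `|t| < eps] = `]- eps, eps[%classic.
  by apply/seteqP; split=> t; rewrite /= in_itv/= -ltr_norml => // -[].
by exists O, eps, g, h; rewrite EJ in gJ hg.
Qed.

End path_submanifold.

Theorem proposition2p4 (R : realType) (alpha : nat) (phi : R -> R)
    (W : set (H1 R * R)) (E : H1 R * R -> R) (B : R -> H1 R * R) :
  (5 <= alpha)%N ->
  pair_potential alpha phi ->
  crack_energy alpha phi W E ->
  B @` `[0, 1] `<=` W ->
  assumption1 E B ->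
  assumption2 E B ->
  submanifold1 alpha.-1 (B @` `[0, 1]) [set B 0; B 1].
Proof.
(* With [alpha = n.+2], one derivative is spent on [d_u E], which leaves the class [n.+1] for the
   curve. *)
case: alpha => [|[|n]]// _ _ [oW _ cE] BW [[cB iB] Bcrit _ Breg _] [c c0 Bcoer].
have BS s : s \in `[0, 1]%R -> d_u E (B s) = 0.
  by move=> sI; apply: Bcrit; exists s.
apply: (path_submanifold (prod_complete (@H1_complete R) (@real_complete R)) oW
  (class_C_d_u oW cE) BW cB iB) => [s s' sI s'I|s sI]; first by rewrite !BS.
have [U [subU codU cU]] := Bcoer s sI.
by apply: (bordered_isomorphism oW cE _ (Breg s sI) subU codU c0 cU); apply: BW; exists s.
Qed.
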